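(* Let $G^{\mathrm{P}}(n,1)$, $n\ge 2$, be the preferential attachment random tree on the vertex set $[n]=\{1,\ldots,n\}$. Then $G^{\mathrm{P}}(n,1)$ obeys the monadic second-order (MSO) 0-1 law: for every MSO sentence $\varphi$ about graphs, the limit $\lim_{n\to\infty}\mathsf{P}\bigl(G^{\mathrm{P}}(n,1)\models\varphi\bigr)$ exists and equals either $0$ or $1$.
   Context: Graphs are finite, simple and undirected. The preferential attachment random tree is defined recursively: $G^{\mathrm{P}}(2,1)$ is the complete graph on $\{1,2\}$ (a single edge). For every $n\ge 2$, given $G^{\mathrm{P}}(n,1)$, the graph $G^{\mathrm{P}}(n+1,1)$ is obtained by adding the vertex $n+1$ and one edge joining $n+1$ to a random vertex of $[n]$, where (conditionally on the history up to $G^{\mathrm{P}}(n,1)$) the vertex $v\in[n]$ is chosen with probability proportional to its degree, i.e. with probability $$\frac{\deg_{G^{\mathrm{P}}(n,1)}v}{2(n-1)}.$$ First-order (FO) sentences about graphs are built from variables $x,y,x_1,\ldots$ (ranging over vertices), logical connectives $\wedge,\vee,\neg,\Rightarrow,\Leftrightarrow$, the binary predicates $\sim$ (adjacency) and $=$ (equality), the quantifiers $\exists,\forall$, and brackets. Vertex labels are not available in the language. Monadic second-order (MSO) sentences are built from the same symbols and, additionally, unary predicate variables $X,Y,X_1,\ldots$ (ranging over subsets of the vertex set), which may also be quantified by $\exists,\forall$; $X(x)$ means that the vertex $x$ belongs to $X$. A sentence has no free variables. $G\models\varphi$ means that $\varphi$ is true on $G$. *)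

(* Defs.v *)
From HB Require Import structures.
From mathcomp Require Import all_boot all_order all_algebra.
From mathcomp Require Import all_classical all_reals all_analysis.

Set Implicit Arguments.
Unset Strict Implicit.
Unset Printing Implicit Defensive.

Import Order.TTheory GRing.Theory Num.Theory.

Local Open Scope ring_scope.

Definition simple_rel (T : finType) (e : {ffun T * T -> bool}) : bool :=
  [forall x, ~~ e (x, x)] && [forall x, forall y, e (x, y) == e (y, x)].

Record sgraph (T : finType) := SGraph {
  edge_fun :> {ffun T * T -> bool};
  _ : simple_rel edge_fun }.

HB.instance Definition _ (T : finType) := [isSub for @edge_fun T].
HB.instance Definition _ (T : finType) := [Finite of sgraph T by <:].

Definition adj (T : finType) (G : sgraph T) (x y : T) : bool := edge_fun G (x, y).

Definition deg (T : finType) (G : sgraph T) (v : T) : nat :=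
  #|[set w | adj G v w]|.

Fact complete_subproof (T : finType) :
  simple_rel [ffun p : T * T => p.1 != p.2].
Proof.
apply/andP; split; first by apply/forallP => x; rewrite ffunE /= eqxx.
by apply/forallP => x; apply/forallP => y; rewrite !ffunE /= [y == x]eq_sym.
Qed.

Definition complete (T : finType) : sgraph T := SGraph (complete_subproof T).

(* The vertices of ['I_n] are identified with the first [n] vertices of
   ['I_n.+1] through [lift ord_max], which preserves the underlying number;
   [unlift ord_max x = None] exactly when [x] is the new vertex [ord_max]. *)
Definition attach_rel (n : nat) (G : sgraph 'I_n) (v : 'I_n)
    (x y : 'I_n.+1) : bool :=
  match unlift ord_max x, unlift ord_max y with
  | Some x', Some y' => adj G x' y'
  | Some x', None => x' == v
  | None, Some y' => y' == v
  | None, None => false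
  end.

Fact attach_subproof (n : nat) (G : sgraph 'I_n) (v : 'I_n) :
  simple_rel [ffun p : 'I_n.+1 * 'I_n.+1 => attach_rel G v p.1 p.2].
Proof.
have /andP[/forallP irrG /forallP symG] := valP G.
apply/andP; split; apply/forallP => x.
  by rewrite ffunE /attach_rel /=; case: unliftP => //= x' _; exact: irrG.
apply/forallP => y; rewrite !ffunE /attach_rel /=.
case: unliftP => [x' _|_]; case: unliftP => [y' _|_] //=.
exact: (forallP (symG x')).
Qed.

Definition attach (n : nat) (G : sgraph 'I_n) (v : 'I_n) : sgraph 'I_n.+1 :=
  SGraph (attach_subproof G v).

(* [pa_law R k G] is the probability that the preferential attachment tree on
   [k + 2] vertices equals the labelled graph [G]. Vertices are numbered from
   [0], so vertex [i] of [[n]] is the ordinal [i - 1]. A labelled tree of this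
   process determines all the earlier ones, so conditioning on the history up to
   a given time is conditioning on the current labelled tree; with [n = k + 2]
   vertices, the normalisation [2 (n - 1)] is [2 (k + 1)]. *)
Fixpoint pa_law (R : realType) (k : nat) : sgraph 'I_k.+2 -> R :=
  match k return sgraph 'I_k.+2 -> R with
  | 0 => fun G => (G == complete 'I_2)%:R
  | k'.+1 => fun G' =>
      \sum_(G : sgraph 'I_k'.+2) pa_law R G *
        (\sum_(v : 'I_k'.+2 | attach G v == G')
           (deg G v)%:R / (2 * k'.+1)%:R)
  end.

(* Vertex variables and set variables are two separate copies of [nat]. *)
Inductive mso : Type :=
  | MAdj of nat & nat
  | MEq of nat & nat
  | MIn of nat & nat (* [MIn X x] is the atom [X(x)] *)
  | MNot of mso
  | MAnd of mso & mso
  | MOr of mso & mso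
  | MImp of mso & mso
  | MIff of mso & mso
  | MEx of nat & mso
  | MAll of nat & mso
  | MExSet of nat & mso
  | MAllSet of nat & mso.

Fixpoint free_vars (phi : mso) : seq nat :=
  match phi with
  | MAdj x y | MEq x y => [:: x; y]
  | MIn _ x => [:: x]
  | MNot p => free_vars p
  | MAnd p q | MOr p q | MImp p q | MIff p q => free_vars p ++ free_vars q
  | MEx x p | MAll x p => [seq y <- free_vars p | y != x]
  | MExSet _ p | MAllSet _ p => free_vars p
  end.

Fixpoint free_set_vars (phi : mso) : seq nat :=
  match phi with
  | MAdj _ _ | MEq _ _ => [::]
  | MIn X _ => [:: X]
  | MNot p => free_set_vars p
  | MAnd p q | MOr p q | MImp p q | MIff p q =>
      free_set_vars p ++ free_set_vars q
  | MEx _ p | MAll _ p => free_set_vars p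
  | MExSet X p | MAllSet X p => [seq Y <- free_set_vars p | Y != X]
  end.

Definition sentence (phi : mso) : Prop :=
  free_vars phi = [::] /\ free_set_vars phi = [::].

Definition update (A : Type) (s : nat -> A) (x : nat) (a : A) : nat -> A :=
  fun y => if y == x then a else s y.

Fixpoint sat (T : finType) (G : sgraph T)
    (s : nat -> T) (S : nat -> {set T}) (phi : mso) : Prop :=
  match phi with
  | MAdj x y => adj G (s x) (s y)
  | MEq x y => s x = s y
  | MIn X x => s x \in S X
  | MNot p => ~ sat G s S p
  | MAnd p q => sat G s S p /\ sat G s S q
  | MOr p q => sat G s S p \/ sat G s S q
  | MImp p q => sat G s S p -> sat G s S q
  | MIff p q => sat G s S p <-> sat G s S q
  | MEx x p => exists v : T, sat G (update s x v) S p
  | MAll x p => forall v : T, sat G (update s x v) S p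
  | MExSet X p => exists A : {set T}, sat G s (update S X A) p
  | MAllSet X p => forall A : {set T}, sat G s (update S X A) p
  end.

(* The truth value of a sentence does not depend on the assignments; all the
   graphs considered here have a nonempty vertex set, so assignments exist. *)
Definition models (T : finType) (G : sgraph T) (phi : mso) : Prop :=
  forall (s : nat -> T) (S : nat -> {set T}), sat G s S phi.

Definition pa_prob (R : realType) (k : nat) (phi : mso) : R :=
  \sum_(G : sgraph 'I_k.+2 | `[< models G phi >]) pa_law R G.

(* Main.v *)
(** The depth-[k] MSO types of trees rooted at a vertex form a finite
commutative monoid under gluing at the root, and this monoid is aperiodic, so
some finite rooted tree [b] has a type that absorbs the type of every rooted
tree.  A tree consisting of a copy of [b] and any other tree sharing only the
root of [b] with it therefore has a type that does not depend on the other tree,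
and it remains to see that such a copy appears with probability tending to [1].

Start at time [n = N - m], where [m] is a small fraction of [N].  At least half
of the vertices have degree at most [4]; each of them is the root of a tentative
copy of [b], which dies when it receives a wrong vertex.  A copy with [i]
missing vertices at [m] steps before time [N] has weight [1 - gain m i].  At
each step at most one copy changes and
[1 + x1 + ... + xK <= exp x1 * ... * exp xK], so the product of the weights is a
supermartingale once each copy satisfies an exponential one-step inequality.
Hence the probability that no copy is complete at time [N] is at most
[(1 - gain m (size b)) ^ K] with [K >= n / 2], while [gain m (size b)] is bounded
below independently of [N]. *)
From HB Require Import structures.
Require Import Defs.
From mathcomp Require Import all_boot all_order all_algebra.
From mathcomp Require Import all_classical all_reals all_analysis.
From mathcomp Require Import fintype finset zify ring lra.
Import Order.TTheory GRing.Theory Num.Theory.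
Import numFieldNormedType.Exports.

Set Implicit Arguments.
Unset Strict Implicit.
Unset Printing Implicit Defensive.

(** * The finite aperiodic monoid of types *)

Section Types.
Variable V : nat.

(** In a structure with [V] sets, [(i, j, Some c)] stands for a non-root vertex of the [i]-th set
    whose membership in the [j]-th set is [c], and [(i, j, None)] for an edge between the two
    sets. *)
Definition atom : finType := ('I_V * 'I_V * option bool)%type.

(** Hintikka types of the game in which a move overwrites one of the [V] sets. A move is labelled by
    the index of that set and by whether the new set contains the root. *)
Fixpoint ty (k : nat) : finType :=
  if k is k'.+1 then ({set atom} * {set ('I_V * bool) * ty k'})%type
  else {set atom}.

Definition atoms (k : nat) : ty k -> {set atom} :=
  if k is k'.+1 then fun t => t.1 else id.

(** A set chosen in the glued graph restricts to one set on each side, and the restrictions agree on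
    the shared root. Only moves with equal labels are therefore combined. *)
Fixpoint mu (k : nat) : ty k -> ty k -> ty k :=
  match k with
  | 0 => fun a b => a :|: b
  | k'.+1 => fun a b =>
      (a.1 :|: b.1,
       [set (x.1, mu x.2 y.2) | x in a.2, y in b.2 & x.1 == y.1])
  end.

Fixpoint ty1 (k : nat) : ty k :=
  match k with
  | 0 => set0
  | k'.+1 => (set0, [set x | x.2 == ty1 k'])
  end.

Definition moves (k : nat) (t : ty k.+1) : {set ('I_V * bool) * ty k} := t.2.

Lemma ty_eqP k (a b : ty k.+1) :
  atoms a = atoms b -> moves a = moves b -> a = b.
Proof. by case: a b => [a1 a2] [b1 b2] /= -> ->. Qed.

Lemma atoms_mu k (a b : ty k) : atoms (mu a b) = atoms a :|: atoms b.
Proof. by case: k a b. Qed.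

Lemma atoms1 k : atoms (ty1 k) = set0.
Proof. by case: k. Qed.

Lemma mem_mu k (a b : ty k.+1) q t :
  reflect (exists x y, [/\ (q, x) \in moves a, (q, y) \in moves b & t = mu x y])
    ((q, t) \in moves (mu a b)).
Proof.
apply: (iffP imset2P) => [[[q1 x] [q2 y] ax] | [x [y [ax bx ->]]]].
  by rewrite inE /= => /andP[bx /eqP e] [-> ->]; subst; exists x, y.
by exists (q, x) (q, y); rewrite // inE /= bx eqxx.
Qed.

Lemma mem_moves1 k q t : ((q, t) \in moves (ty1 k.+1)) = (t == ty1 k).
Proof. by rewrite inE. Qed.

Lemma mu_comm k : commutative (@mu k).
Proof.
elim: k => [|k IH] a b; first exact: setUC.
apply: ty_eqP; first by rewrite !atoms_mu setUC.
by apply/setP => -[q t]; apply/mem_mu/mem_mu => -[x [y [? ? ->]]];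
  exists y, x; rewrite IH.
Qed.

Lemma mu_assoc k : associative (@mu k).
Proof.
elim: k => [|k IH] a b c; first exact: setUA.
apply: ty_eqP; first by rewrite !atoms_mu setUA.
apply/setP => -[q t]; apply/mem_mu/mem_mu.
  move=> [x [_ [ax /mem_mu[y [z [yb zc ->]]] ->]]].
  by exists (mu x y), z; split=> //; apply/mem_mu; exists x, y.
move=> [_ [z [/mem_mu[x [y [ax yb ->]]] zc ->]]].
by exists x, (mu y z); split=> //; apply/mem_mu; exists y, z.
Qed.

Lemma mu1 k : left_id (@ty1 k) (@mu k).
Proof.
elim: k => [|k IH] a; first exact: set0U.
apply: ty_eqP; first by rewrite atoms_mu atoms1 set0U.
apply/setP => -[q t]; apply/mem_mu/idP => [[x [y []]] | at2].
  by rewrite mem_moves1 => /eqP -> ? ->; rewrite IH.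
by exists (ty1 k), t; rewrite IH mem_moves1.
Qed.

HB.instance Definition _ k :=
  Monoid.isComLaw.Build (ty k) (ty1 k) (@mu k)
    (@mu_assoc k) (@mu_comm k) (@mu1 k).

Local Notation pow n t := (iter n (mu t) (ty1 _)).

Lemma mem_pow k n (t : ty k.+1) q y :
  (q, y) \in moves (pow n t) <->
  exists xs : seq (ty k), [/\ size xs = n,
    {in xs, forall x, (q, x) \in moves t} & y = \big[@mu k/ty1 k]_(x <- xs) x].
Proof.
elim: n y => [|n IH] y.
  rewrite mem_moves1; split=> [/eqP ->|[xs [/size0nil -> _ ->]]].
    by exists [::]; rewrite big_nil.
  by rewrite big_nil.
split=> [/mem_mu[x [z [xt /IH[xs [sz xst ->]] ->]]] |
    [[|x xs] [//= [sz] xst ->]]].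
  exists (x :: xs); rewrite /= sz big_cons; split=> // x'.
  by rewrite inE => /orP[/eqP ->|/xst].
apply/mem_mu; exists x, (\big[@mu k/ty1 k]_(x <- xs) x).
rewrite big_cons; split=> //; first by apply: xst; rewrite mem_head.
apply/IH; exists xs; split=> // x' x'xs; apply: xst.
by rewrite inE x'xs orbT.
Qed.

Lemma pow_stable k m (t : ty k) : pow m.+1 t = pow m t ->
  forall n, m <= n -> pow n t = pow m t.
Proof.
by move=> e n /subnK <-; elim: (n - m) => //= d ->.
Qed.

Lemma pigeonhole (T : finType) (xs : seq T) m :
  #|T| * m < size xs -> exists x, m < count_mem x xs.
Proof.
move=> lt; apply/existsP; apply: contraLR lt => /existsPn H.
rewrite -leqNgt.
have -> : size xs = \sum_(x : T) count_mem x xs.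
  elim: xs {H} => [|a xs IH] /=; first by rewrite big1.
  rewrite big_split /= -IH (bigD1 a) //= eqxx big1 // => i.
  by rewrite eq_sym => /negPf ->.
rewrite -sum_nat_const; apply: leq_sum => x _; rewrite leqNgt; exact: H.
Qed.

Lemma big_count k (xs : seq (ty k)) x :
  \big[@mu k/ty1 k]_(y <- xs) y =
  mu (pow (count_mem x xs) x)
    (\big[@mu k/ty1 k]_(y <- [seq y <- xs | y != x]) y).
Proof.
rewrite big_filter (bigID (pred1 x)) /=; congr mu.
elim: xs => [|a xs IH]; first by rewrite big_nil.
by rewrite big_cons /= IH; case: eqP => [->|].
Qed.

Lemma size_count_filter (T : eqType) (x : T) xs :
  size xs = count_mem x xs + size [seq y <- xs | y != x].
Proof. by rewrite size_filter -(count_predC (pred1 x)). Qed.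

Lemma mem_nseq_filter (T : eqType) (x : T) xs : 0 < count_mem x xs ->
  forall c, {subset nseq c x ++ [seq y <- xs | y != x] <= xs}.
Proof.
rewrite -has_count has_pred1 => xxs c y.
rewrite mem_cat mem_nseq mem_filter.
by case/orP => [/andP[_ /eqP ->] | /andP[_]].
Qed.

(* At depth [k.+1], a factor of [pow n t] is a product of [n] depth-[k] types,
   one of which is repeated often enough to gain or lose one copy for free. *)
Lemma mu_aperiodic k : exists m, forall t : ty k, pow m.+1 t = pow m t.
Proof.
elim: k => [|k [m IH]].
  by exists 1 => t; rewrite /= setU0 setUid.
have st (x : ty k) n : m <= n -> pow n x = pow m x by exact: pow_stable.
(* Among more than [#|ty k| * m] factors some type occurs more than [m] times, and its powers are
   constant from exponent [m] on. *)
exists (#|ty k| * m).+1 => t; set n := (#|ty k| * m).+1.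
have E1 j : atoms (pow j.+1 t) = atoms t.
  elim: j => [|j IHj]; first by rewrite atoms_mu atoms1 setU0.
  by rewrite iterS atoms_mu IHj setUid.
apply: ty_eqP; first by rewrite /n !E1.
have grab (xs : seq (ty k)) : n <= size xs -> exists x, m < count_mem x xs.
  exact: pigeonhole.
apply/setP => -[q y]; apply/idP/idP => /mem_pow[xs [sz xst ->]].
  have [x cx] : exists x, m < count_mem x xs by apply: grab; rewrite sz.
  apply/mem_pow; rewrite (big_count xs x).
  have := size_count_filter x xs; have sub := @mem_nseq_filter _ x xs.
  case: (count_mem x xs) cx sub => // c cx sub.
  set r := [seq y <- xs | _] in sub * => szr.
  exists (nseq c x ++ r); split.
  - by rewrite size_cat size_nseq; move: szr; rewrite sz addSn => -[].
  - by move=> z zin; apply/xst/(sub isT c).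
  - rewrite big_cat big_nseq /=; congr mu; rewrite st //.
    by have /= E := IH x; rewrite !E.
have [x cx] : exists x, m < count_mem x xs by apply: grab; rewrite sz.
apply/mem_pow; rewrite (big_count xs x).
have := size_count_filter x xs; have sub := @mem_nseq_filter _ x xs.
case: (count_mem x xs) cx sub => // c cx sub.
set r := [seq y <- xs | _] in sub * => szr.
exists (nseq c.+2 x ++ r); split.
- by rewrite size_cat size_nseq addSn -szr sz.
- by move=> z zin; apply/xst/(sub isT c.+2).
- rewrite big_cat big_nseq /=; congr mu; rewrite st //.
  by have /= E := IH x; rewrite !E.
Qed.

End Types.

(** * Types of rooted graphs and gluing at the root *)

Section GraphTypes.
Variable V : nat.

Definition tp0 (T : finType) (G : sgraph T) (A : {set T}) (r : T)
    (P : nat -> {set T}) : {set atom V} :=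
  [set q : atom V |
    if q.2 is Some b
    then [exists x in A, [&& x != r, x \in P q.1.1 & (x \in P q.1.2) == b]]
    else [exists x in A, exists y in A,
            [&& x \in P q.1.1, y \in P q.1.2 & adj G x y]]].

(* The root contributes to no atom except through its edges: its membership in
   a chosen set is recorded by the boolean of the move.  This makes the type of
   a one-vertex tree the unit of [mu]. *)
Fixpoint tp (k : nat) (T : finType) (G : sgraph T) (A : {set T}) (r : T)
    (P : nat -> {set T}) : ty V k :=
  match k with
  | 0 => tp0 G A r P
  | k'.+1 => (tp0 G A r P,
      [set (ix.1, r \in ix.2, tp k' G A r (update P ix.1 ix.2))
         | ix : 'I_V * {set T}])
  end.

Lemma atoms_tp k T (G : sgraph T) A r P : atoms (tp k G A r P) = tp0 G A r P.
Proof. by case: k. Qed.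

Lemma mem_moves_tp k T (G : sgraph T) A r P (i : 'I_V) b t :
  reflect (exists2 X : {set T}, (r \in X) = b & t = tp k G A r (update P i X))
    ((i, b, t) \in moves (tp k.+1 G A r P)).
Proof.
apply: (iffP imsetP) => [[[j X] _ [-> -> ->]] | [X <- ->]]; first by exists X.
by exists (i, X).
Qed.

Section Isomorphism.
Variables (T T' : finType) (G : sgraph T) (G' : sgraph T') (f : T -> T').
Variables (A : {set T}) (r : T).
Hypothesis injf : {in A &, injective f}.
Hypothesis rA : r \in A.
Hypothesis adjf : {in A &, forall x y, adj G' (f x) (f y) = adj G x y}.

Lemma tp0_iso (P : nat -> {set T}) (P' : nat -> {set T'}) :
  (forall i, {in A, forall x, (f x \in P' i) = (x \in P i)}) ->
  tp0 G' (f @: A) (f r) P' = tp0 G A r P.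
Proof.
move=> Pf; apply/setP => -[[i j] [b|]]; rewrite !inE /=;
  apply/exists_inP/exists_inP.
- move=> [_ /imsetP[x xA ->]].
  by rewrite (inj_in_eq injf) // !Pf // => h; exists x.
- move=> [x xA h]; exists (f x); rewrite ?imset_f //.
  by rewrite (inj_in_eq injf) // !Pf.
- move=> [_ /imsetP[x xA ->]] /exists_inP[_ /imsetP[y yA ->]].
  rewrite !Pf // adjf // => h; exists x => //.
  by apply/exists_inP; exists y.
- move=> [x xA] /exists_inP[y yA h]; exists (f x); rewrite ?imset_f //.
  by apply/exists_inP; exists (f y); rewrite ?imset_f // !Pf // adjf.
Qed.

Lemma tp_iso k (P : nat -> {set T}) (P' : nat -> {set T'}) :
  (forall i, {in A, forall x, (f x \in P' i) = (x \in P i)}) ->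
  tp k G' (f @: A) (f r) P' = tp k G A r P.
Proof.
elim: k P P' => [|k IH] P P' Pf; first exact: tp0_iso.
apply: ty_eqP; first by rewrite !atoms_tp; exact: tp0_iso.
apply/setP => -[[i b] t]; apply/mem_moves_tp/mem_moves_tp => -[X bX ->].
  exists (f @^-1: X); first by rewrite inE.
  by apply: IH => j x xA; rewrite /update; case: eqP => _; rewrite ?inE // Pf.
(* Injectivity of [f] is known only on [A], so only the part of [X] inside [A] is pushed forward. *)
exists (f @: (X :&: A)).
  rewrite -bX; apply/imsetP/idP => [[x /setIP[xX xA] /injf ->] // | rX].
  by exists r; rewrite // inE rX.
apply/esym; apply: IH => j x xA.
rewrite /update; case: eqP => _; last exact: Pf.
apply/imsetP/idP => [[y /setIP[yX yA] /injf ->] // | xX].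
by exists x; rewrite // inE xX.
Qed.

End Isomorphism.

Lemma tp_local k T (G : sgraph T) (A : {set T}) r (P P' : nat -> {set T}) :
  r \in A -> (forall i, {in A, forall x, (x \in P' i) = (x \in P i)}) ->
  tp k G A r P' = tp k G A r P.
Proof.
move=> rA h; rewrite -[A in LHS]imset_id.
exact: (@tp_iso _ _ G G id A r).
Qed.

Section Merge.
Variables (T : finType) (G : sgraph T) (A B : {set T}) (r : T).
Hypothesis edge : {in A :|: B &, forall x y, adj G x y ->
  (x \in A) && (y \in A) || (x \in B) && (y \in B)}.

Lemma tp0_merge P : tp0 G (A :|: B) r P = tp0 G A r P :|: tp0 G B r P.
Proof.
apply/setP => -[[i j] [b|]]; rewrite !inE /=; apply/exists_inP/orP.
- by move=> [x /setUP[xA|xB] h]; [left|right]; apply/exists_inP; exists x.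
- by case=> /exists_inP[x xA h]; exists x; rewrite // inE xA ?orbT.
- move=> [x xAB] /exists_inP[y yAB /and3P[xi yj a]].
  by case/orP: (edge xAB yAB a) => /andP[xA yA]; [left|right];
    apply/exists_inP; exists x => //; apply/exists_inP; exists y;
    rewrite ?xi ?yj.
- by case=> /exists_inP[x xA] /exists_inP[y yA h]; exists x;
    rewrite ?inE ?xA ?orbT //; apply/exists_inP; exists y;
    rewrite ?inE ?yA ?orbT.
Qed.

(** The composition method at a single shared vertex: by [edge] every edge lies within one side, so
    the atoms are united, and each round of the game splits into one round per side. *)
Lemma tp_merge k P : r \in A -> r \in B -> A :&: B \subset [set r] ->
  tp k G (A :|: B) r P = mu (tp k G A r P) (tp k G B r P).
Proof.
move=> rA rB /subsetP AB; elim: k P => [|k IH] P; first exact: tp0_merge.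
apply: ty_eqP; first by rewrite atoms_mu !atoms_tp tp0_merge.
apply/setP => -[[i b] t]; apply/mem_moves_tp/mem_mu.
  move=> [X bX ->]; rewrite IH.
  exists (tp k G A r (update P i X)), (tp k G B r (update P i X)).
  by split=> //; apply/mem_moves_tp; exists X.
move=> [_ [_ [/mem_moves_tp[X bX ->] /mem_moves_tp[Y bY ->] ->]]].
(* The two choices are cut down to their own sides before being united; at the root they agree
   because both moves carry the same boolean. *)
exists (X :&: A :|: Y :&: B); first by rewrite !inE rA rB bX bY !andbT orbb.
rewrite IH; congr mu; apply/esym; apply: tp_local => // j x xA;
  rewrite /update; case: eqP => // _; rewrite !inE xA andbT.
- case xB: (x \in B); rewrite ?andbF ?orbF //.
  have /set1P -> : x \in [set r] by apply: AB; rewrite inE xA.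
  by rewrite bX bY; case: (b).
- case xB: (x \in A); rewrite ?andbF ?orbF //.
  have /set1P -> : x \in [set r] by apply: AB; rewrite inE xA xB.
  by rewrite bX bY; case: (b).
Qed.

End Merge.

(** A position of the game from which [k] rounds do not distinguish the two rooted graphs. The atoms
    do not record which sets contain the root, so this is compared separately. *)
Definition sim k (T T' : finType) (G : sgraph T) (G' : sgraph T')
    (r : T) (r' : T') (P : nat -> {set T}) (P' : nat -> {set T'}) :=
  (forall i, (r \in P i) = (r' \in P' i)) /\
  tp k G [set: T] r P = tp k G' [set: T'] r' P'.

Section Sim.
Variables (k : nat) (T T' : finType) (G : sgraph T) (G' : sgraph T').
Variables (r : T) (r' : T').
Implicit Types (P : nat -> {set T}) (Q : nat -> {set T'}).

Lemma sim_sym P Q : sim k G G' r r' P Q -> sim k G' G r' r Q P.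
Proof. by case=> h1 h2; split. Qed.

Lemma sim_move P Q i : sim k.+1 G G' r r' P Q -> i < V ->
  forall X, exists X', sim k G G' r r' (update P i X) (update Q i X').
Proof.
move=> [hr ht] iV X.
have : (Ordinal iV, r \in X, tp k G [set: T] r (update P (Ordinal iV) X))
    \in moves (tp k.+1 G [set: T] r P) by apply/mem_moves_tp; exists X.
rewrite ht => /mem_moves_tp[X' bX' e]; exists X'; split => // j.
by rewrite /update; case: eqP.
Qed.

Lemma sim_atoms P Q : sim k G G' r r' P Q ->
  tp0 G [set: T] r P = tp0 G' [set: T'] r' Q.
Proof. by case=> _ /(congr1 (@atoms V k)); rewrite !atoms_tp. Qed.

Lemma sim_mem P Q i j b : sim k G G' r r' P Q -> i < V -> j < V ->
  (exists2 x, x \in P i & (x \in P j) = b) ->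
  (exists2 x, x \in Q i & (x \in Q j) = b).
Proof.
move=> sPP iV jV [x xi xj].
case: (eqVneq x r) => [xr | nxr].
  by exists r'; rewrite -sPP.1 -xr.
have : (Ordinal iV, Ordinal jV, Some b) \in tp0 G [set: T] r P.
  by rewrite inE; apply/exists_inP; exists x; rewrite //= nxr xi xj eqxx.
rewrite (sim_atoms sPP) inE => /exists_inP[y _ /and3P[_ yi /eqP yj]].
by exists y.
Qed.

Lemma sim_adj P Q i j : sim k G G' r r' P Q -> i < V -> j < V ->
  (exists x y, [/\ x \in P i, y \in P j & adj G x y]) ->
  (exists x y, [/\ x \in Q i, y \in Q j & adj G' x y]).
Proof.
move=> sPP iV jV [x [y [xi yj a]]].
have : (Ordinal iV, Ordinal jV, None) \in tp0 G [set: T] r P.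
  rewrite inE; apply/exists_inP; exists x => //.
  by apply/exists_inP; exists y => //; exact/and3P.
rewrite (sim_atoms sPP) inE => /exists_inP[x' _].
move=> /exists_inP[y' _ /and3P[? ? ?]].
by exists x', y'.
Qed.

End Sim.

(** If [P' i] had two elements, choosing one of them as a new set would split [P' i], whereas no set
    splits the singleton [P i]. The test spends one move, hence the depth [k.+1], and overwrites an
    index other than [i], hence [1 < V]. *)
Lemma sim_set1 k (T T' : finType) (G : sgraph T) (G' : sgraph T')
    (r : T) (r' : T') (P : nat -> {set T}) (P' : nat -> {set T'}) i v :
  sim k.+1 G G' r r' P P' -> i < V -> 1 < V -> P i = [set v] ->
  exists v', P' i = [set v'].
Proof.
move=> sPP iV V1 Pi.
have [v' v'i _] : exists2 v', v' \in P' i & (v' \in P' i) = true.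
  by apply: (sim_mem sPP) => //; exists v; rewrite Pi set11.
exists v'; apply/eqP; rewrite eqEsubset sub1set v'i andbT.
apply/subsetP => w' w'i; apply: contraT; rewrite inE => nw'.
pose j := if i == 0 then 1 else 0.
have jV : j < V by rewrite /j; case: ifP => // _; exact: ltnW.
have ji : (i == j) = false by rewrite /j; case: (i).
have [Y sY] := sim_move (sim_sym sPP) jV [set v'].
have vY : v \in Y.
  have [] // := @sim_mem _ _ _ _ _ _ _ _ _ i j true sY iV jV.
    by exists v'; rewrite /update ?ji // eqxx set11.
  by move=> x; rewrite /update ji eqxx Pi inE => /eqP ->.
have [] // := @sim_mem _ _ _ _ _ _ _ _ _ i j false sY iV jV.
  by exists w'; rewrite /update ?ji // eqxx in_set1 (negPf nw').
by move=> x; rewrite /update ji eqxx Pi inE => /eqP ->; rewrite vY.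
Qed.

End GraphTypes.

(** * MSO truth is determined by the type *)

(* Vertex variable [x] becomes the set variable [x.*2], holding a singleton, and
   set variable [X] becomes [X.*2.+1]. *)
Fixpoint vmax (phi : mso) : nat :=
  match phi with
  | MAdj x y | MEq x y | MIn x y => maxn x y
  | MNot p => vmax p
  | MAnd p q | MOr p q | MImp p q | MIff p q => maxn (vmax p) (vmax q)
  | MEx x p | MAll x p | MExSet x p | MAllSet x p => maxn x (vmax p)
  end.

(** Atomic formulas have depth 1 so that, after the move for a vertex quantifier, a move remains to
    certify that the answer is a singleton. *)
Fixpoint qdepth (phi : mso) : nat :=
  match phi with
  | MAdj _ _ | MEq _ _ | MIn _ _ => 1
  | MNot p => qdepth p
  | MAnd p q | MOr p q | MImp p q | MIff p q => maxn (qdepth p) (qdepth q)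
  | MEx _ p | MAll _ p | MExSet _ p | MAllSet _ p => (qdepth p).+1
  end.

Lemma qdepth_gt0 phi : 0 < qdepth phi.
Proof. by elim: phi => //= p hp q hq; rewrite leq_max hp. Qed.

Definition represents (T : finType) (phi : mso) (P : nat -> {set T})
    (s : nat -> T) (S : nat -> {set T}) :=
  (forall x, x \in free_vars phi -> P x.*2 = [set s x]) /\
  (forall X, X \in free_set_vars phi -> P X.*2.+1 = S X).

Lemma update_eq A (s : nat -> A) x a : update s x a x = a.
Proof. by rewrite /update eqxx. Qed.

Lemma represents_ex (T : finType) x p q (P : nat -> {set T}) s S (v : T) :
  q = MEx x p \/ q = MAll x p -> represents q P s S ->
  represents p (update P x.*2 [set v]) (update s x v) S.
Proof.
move=> eq; rewrite /represents.
have [-> ->] : free_vars q = free_vars (MEx x p) /\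
  free_set_vars q = free_set_vars p by case: eq => ->.
move=> [h1 h2]; split=> [y yp | X Xp]; rewrite /update.
  rewrite (inj_eq double_inj); case: eqP => // yx; apply: h1.
  by rewrite mem_filter yp andbT; apply/eqP.
by rewrite h2 //; case: eqP => //; lia.
Qed.

Lemma represents_exset (T : finType) X p q (P : nat -> {set T}) s S
    (A : {set T}) :
  q = MExSet X p \/ q = MAllSet X p -> represents q P s S ->
  represents p (update P X.*2.+1 A) s (update S X A).
Proof.
move=> eq; rewrite /represents; have [-> ->] : free_vars q = free_vars p /\
  free_set_vars q = free_set_vars (MExSet X p) by case: eq => ->.
move=> [h1 h2]; split=> [y yp | Y Yp]; rewrite /update.
  by rewrite h1 //; case: eqP => //; lia.
rewrite eqSS (inj_eq double_inj); case: eqP => // YX; apply: h2.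
by rewrite mem_filter Yp andbT; apply/eqP.
Qed.

Lemma represents_cat (T : finType) p q pq (P : nat -> {set T})
    (s : nat -> T) S :
  free_vars pq = free_vars p ++ free_vars q ->
  free_set_vars pq = free_set_vars p ++ free_set_vars q ->
  represents pq P s S -> represents p P s S /\ represents q P s S.
Proof.
move=> e1 e2 [h1 h2]; split; split=> x xp.
- by apply: h1; rewrite e1 mem_cat xp.
- by apply: h2; rewrite e2 mem_cat xp.
- by apply: h1; rewrite e1 mem_cat xp orbT.
- by apply: h2; rewrite e2 mem_cat xp orbT.
Qed.

Lemma sat_sim V phi : forall k (T T' : finType) (G : sgraph T) (G' : sgraph T')
    (r : T) (r' : T') (P : nat -> {set T}) (P' : nat -> {set T'}) s S s' S',
  qdepth phi <= k -> (vmax phi).*2.+1 < V -> sim V k G G' r r' P P' ->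
  represents phi P s S -> represents phi P' s' S' ->
  sat G s S phi <-> sat G' s' S' phi.
Proof.
(* [sim] is symmetric, so one implication, proved for all pairs of structures, gives the
   equivalence. *)
have half p :
  (forall k (T T' : finType) (G : sgraph T) (G' : sgraph T')
      (r : T) (r' : T') (P : nat -> {set T}) (P' : nat -> {set T'}) s S s' S',
    qdepth p <= k -> (vmax p).*2.+1 < V -> sim V k G G' r r' P P' ->
    represents p P s S -> represents p P' s' S' ->
    sat G s S p -> sat G' s' S' p) ->
  (forall k (T T' : finType) (G : sgraph T) (G' : sgraph T')
      (r : T) (r' : T') (P : nat -> {set T}) (P' : nat -> {set T'}) s S s' S',
    qdepth p <= k -> (vmax p).*2.+1 < V -> sim V k G G' r r' P P' ->
    represents p P s S -> represents p P' s' S' ->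
    sat G s S p <-> sat G' s' S' p).
  move=> H k T T' G G' r r' P P' s S s' S' hk hV h hs hs'; split.
    exact: (H k _ _ _ _ r r' P P').
  by apply: (H k _ _ _ _ r' r P' P) => //; exact: sim_sym.
elim: phi => [x y|x y|X x|p IH|p IHp q IHq|p IHp q IHq|p IHp q IHq|p IHp q IHq
  |x p IH|x p IH|X p IH|X p IH].
5-8: move=> k T T' G G' r r' P P' s S s' S' /=; rewrite geq_max => /andP[kp kq];
  move=> hV h /(@represents_cat _ p q)[] // hp hq;
  move=> /(@represents_cat _ p q)[] // hp' hq';
  have pV : (vmax p).*2.+1 < V by [lia];
  have qV : (vmax q).*2.+1 < V by [lia];
  have ip := IHp _ _ _ _ _ _ _ _ _ _ _ _ _ kp pV h hp hp';
  have iq := IHq _ _ _ _ _ _ _ _ _ _ _ _ _ kq qV h hq hq';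
  by rewrite ip iq.
- apply: half => k T T' G G' r r' P P' s S s' S' /= hk hV h [hs _] [hs' _] a.
  have [|||x' [y' []]] := sim_adj h (i := x.*2) (j := y.*2); try lia.
    by exists (s x), (s y); rewrite !hs ?inE ?eqxx ?orbT.
  by rewrite !hs' ?inE ?eqxx ?orbT // => /eqP -> /eqP ->.
- apply: half => k T T' G G' r r' P P' s S s' S' /= hk hV h [hs _] [hs' _] a.
  have [|||z] := sim_mem h (i := x.*2) (j := y.*2) (b := true); try lia.
    by exists (s x); rewrite !hs ?inE ?eqxx ?orbT // a eqxx.
  by rewrite !hs' ?inE ?eqxx ?orbT // => /eqP -> /eqP ->.
- apply: half => k T T' G G' r r' P P' s S s' S' /= hk hV h [hs hS] [hs' hS'] a.
  have [|||z] := sim_mem h (i := x.*2) (j := X.*2.+1) (b := true); try lia.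
    by exists (s x); rewrite ?hs ?hS ?inE ?eqxx // a.
  by rewrite ?hs' ?hS' ?inE ?eqxx // => /eqP ->.
- move=> k T T' G G' r r' P P' s S s' S' /= hk hV h hs hs'.
  by rewrite (IH _ _ _ _ _ _ _ _ _ _ _ _ _ hk hV h hs hs').
- apply: half => -[|k] // T T' G G' r r' P P' s S s' S' /= hk hV h hs hs' [v a].
  have xV : x.*2 < V by lia.
  have [X' h'] := sim_move h xV [set v].
  case: k h h' hk => [|k] h h' hk; first by have := qdepth_gt0 p; lia.
  (* The answer to a singleton is a singleton, so it names a vertex. *)
  have [||v' eX'] := sim_set1 h' xV (v := v); rewrite ?update_eq //; first lia.
  exists v'; rewrite update_eq in eX'; rewrite eX' in h'.
  apply: (IH _ _ _ _ _ _ _ _ _ _ _ _ _ _ _ h' _ _).1 a => //; first lia.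
    by apply: represents_ex hs; left.
  by apply: represents_ex hs'; left.
- apply: half => -[|k] // T T' G G' r r' P P' s S s' S' /= hk hV h hs hs' a v'.
  have xV : x.*2 < V by lia.
  (* For a universal quantifier the challenge comes from the second structure. *)
  have [X' h'] := sim_move (sim_sym h) xV [set v'].
  case: k h h' hk => [|k] h h' hk; first by have := qdepth_gt0 p; lia.
  have [||v eX'] := sim_set1 h' xV (v := v'); rewrite ?update_eq //; first lia.
  rewrite update_eq in eX'; rewrite eX' in h'.
  apply: (IH _ _ _ _ _ _ _ _ _ _ _ _ _ _ _ h' _ _).2 (a v) => //; first lia.
    by apply: represents_ex hs'; right.
  by apply: represents_ex hs; right.
- apply: half => -[|k] // T T' G G' r r' P P' s S s' S' /= hk hV h hs hs' [A a].
  have XV : X.*2.+1 < V by lia.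
  have [A' h'] := sim_move h XV A; exists A'.
  apply: (IH _ _ _ _ _ _ _ _ _ _ _ _ _ _ _ h' _ _).1 a => //; first lia.
    by apply: represents_exset hs; left.
  by apply: represents_exset hs'; left.
- apply: half => -[|k] // T T' G G' r r' P P' s S s' S' /= hk hV h hs hs' a A'.
  have XV : X.*2.+1 < V by lia.
  have [A h'] := sim_move (sim_sym h) XV A'.
  apply: (IH _ _ _ _ _ _ _ _ _ _ _ _ _ _ _ h' _ _).2 (a A) => //; first lia.
    by apply: represents_exset hs'; right.
  by apply: represents_exset hs; right.
Qed.

Lemma models_tp V k phi (T T' : finType) (G : sgraph T) (G' : sgraph T')
    (r : T) (r' : T') :
  sentence phi -> qdepth phi <= k -> (vmax phi).*2.+1 < V ->
  tp V k G [set: T] r (fun=> set0) = tp V k G' [set: T'] r' (fun=> set0) ->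
  models G phi <-> models G' phi.
Proof.
move=> [fv fs] hk hV e.
have key s S s' S' : sat G s S phi <-> sat G' s' S' phi.
  apply: (@sat_sim V phi k _ _ _ _ r r' (fun=> set0) (fun=> set0)) => //.
  - by split=> // i; rewrite !inE.
  - by split=> x; rewrite ?fv ?fs.
  - by split=> x; rewrite ?fv ?fs.
by split=> m s S; [apply/(key (fun=> r) (fun=> set0)) |
  apply/(key _ _ (fun=> r') (fun=> set0))]; exact: m.
Qed.

(** * Coded trees and an absorbing tree *)

Section Adj.
Variables (T : finType) (G : sgraph T).

Lemma adj_irr x : adj G x x = false.
Proof. by have /andP[/forallP/(_ x)/negPf] := valP G. Qed.

Lemma adj_sym x y : adj G x y = adj G y x.
Proof. by have /andP[_ /forallP/(_ x)/forallP/(_ y)/eqP] := valP G. Qed.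

End Adj.

(* A rooted tree is coded by the list of the parents of its vertices
   [1, 2, ...], the root being [0]. *)
Definition parents_ok (p : seq nat) :=
  forall i, i < size p -> nth 0 p i <= i.

(** [u :: s] spans an induced copy of the graph coded by [p]. The root has no parent entry, so the
    parent of position [b] stands at index [b.-1]. *)
Definition enumerates (T : finType) (G : sgraph T) (p : seq nat) (u : T)
    (s : seq T) :=
  [/\ uniq (u :: s), size s = size p &
      forall a b, a < b <= size p ->
        adj G (nth u (u :: s) a) (nth u (u :: s) b) = (nth 0 p b.-1 == a)].

Definition is_parent (p : seq nat) (a b : nat) : bool :=
  (a < b) && (nth 0 p b.-1 == a).

Fact parent_graph_subproof (p : seq nat) :
  simple_rel [ffun xy : 'I_(size p).+1 * 'I_(size p).+1 =>
    is_parent p xy.1 xy.2 || is_parent p xy.2 xy.1].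
Proof.
apply/andP; split; apply/forallP => x.
  by rewrite ffunE /is_parent /= ltnn.
by apply/forallP => y; rewrite !ffunE orbC.
Qed.

Definition parent_graph (p : seq nat) : sgraph 'I_(size p).+1 :=
  SGraph (parent_graph_subproof p).

Lemma adj_parent_graph p a b :
  adj (parent_graph p) a b = is_parent p a b || is_parent p b a.
Proof. by rewrite /adj /= ffunE. Qed.

Section TreeTypes.
Variables V k : nat.

Definition tree_type (p : seq nat) : ty V k :=
  tp V k (parent_graph p) [set: _] ord0 (fun=> set0).

Lemma tp_enumerates (T : finType) (G : sgraph T) p u s : enumerates G p u s ->
  tp V k G [set x in u :: s] u (fun=> set0) = tree_type p.
Proof.
move=> [us sz adjs].
have sz1 : size (u :: s) = (size p).+1 by rewrite /= sz.
pose f (i : 'I_(size p).+1) := nth u (u :: s) i.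
have <- : f @: [set: _] = [set x in u :: s].
  apply/setP => x; rewrite inE; apply/imsetP/idP => [[i _ ->]|].
    by rewrite mem_nth // sz1.
  move=> xs; have lt : index x (u :: s) < (size p).+1 by rewrite -sz1 index_mem.
  exists (Ordinal lt); first exact: in_setT.
  exact/esym/nth_index.
apply: (@tp_iso V _ _ (parent_graph p) G f _ ord0).
- move=> i j _ _ /eqP; rewrite nth_uniq ?sz1 //.
  by move=> /eqP /val_inj.
- exact: in_setT.
- move=> i j _ _; rewrite adj_parent_graph /is_parent.
  have [ij|ji|/val_inj ->] := ltngtP i j.
  + by rewrite adjs ?orbF // ij -ltnS ltn_ord.
  + by rewrite adj_sym adjs // ji -ltnS ltn_ord.
  + by rewrite adj_irr.
- by move=> i x _; rewrite !inE.
Qed.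

Lemma tp_root (T : finType) (G : sgraph T) r P :
  tp V k G [set r] r P = ty1 V k.
Proof.
have E0 Q : tp0 V G [set r] r Q = set0.
  apply/setP => -[[i j] [b|]]; rewrite !inE /=; apply/exists_inP.
    by case=> x /set1P ->; rewrite eqxx.
  case=> x /set1P -> /exists_inP[y /set1P ->]; by rewrite adj_irr !andbF.
elim: k P => [|k' IH] P; first exact: E0.
apply: ty_eqP; first by rewrite atoms_tp E0.
apply/setP => -[[i b] t]; rewrite mem_moves1.
apply/mem_moves_tp/eqP => [[X _ ->] | ->]; first exact: IH.
exists (if b then [set r] else set0); last by rewrite IH.
by case: b; rewrite inE ?eqxx.
Qed.

Lemma tree_type0 : tree_type [::] = ty1 V k.
Proof.
rewrite -(tp_root (parent_graph [::]) ord0 (fun=> set0)); congr tp.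
by apply/setP => i; rewrite !inE ord1.
Qed.

(** Gluing at the root: the root [0] is shared, and the other vertices of [q] are numbered after
    those of [p]. *)
Definition join (p q : seq nat) : seq nat :=
  p ++ [seq if i == 0 then 0 else i + size p | i <- q].

Lemma size_join p q : size (join p q) = size p + size q.
Proof. by rewrite size_cat size_map. Qed.

Lemma nth_join_l p q i : i < size p -> nth 0 (join p q) i = nth 0 p i.
Proof. by move=> ip; rewrite nth_cat ip. Qed.

Lemma nth_join_r p q i : i < size q -> nth 0 (join p q) (i + size p) =
  if nth 0 q i == 0 then 0 else nth 0 q i + size p.
Proof.
by move=> iq; rewrite nth_cat ltnNge leq_addl addnK (nth_map 0).
Qed.

Lemma parents_ok_join p q :
  parents_ok p -> parents_ok q -> parents_ok (join p q).
Proof.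
move=> hp hq i; rewrite size_join => ipq.
have [ip|ip] := ltnP i (size p); first by rewrite nth_join_l // hp.
rewrite -(subnK ip) nth_join_r; last by lia.
by case: eqP => // _; rewrite leq_add2r hq //; lia.
Qed.

Lemma tree_type_join p q :
  tree_type (join p q) = mu (tree_type p) (tree_type q).
Proof.
set G := parent_graph (join p q).
pose sp : seq 'I_(size (join p q)).+1 := mkseq (fun i => inord i.+1) (size p).
pose sq : seq 'I_(size (join p q)).+1 :=
  mkseq (fun i => inord (i.+1 + size p)) (size q).
have vp i : i <= size p -> nth ord0 (ord0 :: sp) i = i :> nat.
  case: i => //= i ip; rewrite nth_mkseq // inordK // size_join; lia.
have vq i : i <= size q ->
    nth ord0 (ord0 :: sq) i = (if i == 0 then 0 else i + size p) :> nat.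
  case: i => //= i ip; rewrite nth_mkseq // inordK // size_join; lia.
have szp : size sp = size p by rewrite size_mkseq.
have szq : size sq = size q by rewrite size_mkseq.
have ep : enumerates G p ord0 sp.
  split=> //.
    apply/(uniqP ord0) => i j; rewrite !inE /= szp !ltnS => ip jp /(congr1 val).
    by rewrite /= !vp.
  move=> a b /andP[ab bp]; rewrite adj_parent_graph /is_parent !vp //; last lia.
  by rewrite ab ltnNge (ltnW ab) /= orbF nth_join_l //; lia.
have eq : enumerates G q ord0 sq.
  split=> //.
    apply/(uniqP ord0) => i j; rewrite !inE /= szq !ltnS => ip jp /(congr1 val).
    by rewrite /= !vq //; do 2![case: eqP]; lia.
  move=> a [//|b] /andP[ab bp].
  rewrite adj_parent_graph /is_parent !vq //; last lia.
  rewrite addSn /= nth_join_r // [_ < if _ then _ else _]ltnNge.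
  have -> : (if a == 0 then 0 else a + size p) < (b + size p).+1.
    by case: eqP; lia.
  have -> : (if a == 0 then 0 else a + size p) <= (b + size p).+1.
    by case: eqP; lia.
  by rewrite orbF /=; apply/eqP/eqP; do 2![case: eqP]; lia.
rewrite -(tp_enumerates ep) -(tp_enumerates eq) -tp_merge.
- congr tp; apply/esym/setP => x; rewrite !inE.
  have [xp|xp] := leqP x (size p).
    apply/orP; left; have -> : x = nth ord0 (ord0 :: sp) x.
      by apply: val_inj; rewrite /= vp.
    by rewrite -in_cons mem_nth //= szp.
  have xq : x < (size p + size q).+1 by rewrite -size_join.
  apply/orP; right; have -> : x = nth ord0 (ord0 :: sq) (x - size p).
    by apply: val_inj; rewrite /= vq; [case: eqP; lia | lia].
  by rewrite -in_cons mem_nth //= szq; lia.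
- move=> x y _ _; rewrite !inE -!in_cons => xy.
  have inA (z : 'I_(size (join p q)).+1) : z <= size p -> z \in ord0 :: sp.
    move=> zp; have -> : z = nth ord0 (ord0 :: sp) z.
      by apply: val_inj; rewrite /= vp.
    by rewrite mem_nth //= szp.
  have inB (z : 'I_(size (join p q)).+1) :
      (z == 0 :> nat) || (size p < z) -> z \in ord0 :: sq.
    case/orP => [/eqP z0|zp].
      by have -> : z = ord0 by [apply: val_inj]; rewrite mem_head.
    have zq : z < (size p + size q).+1 by rewrite -size_join.
    have -> : z = nth ord0 (ord0 :: sq) (z - size p).
      by apply: val_inj; rewrite /= vq; [case: eqP; lia | lia].
    by rewrite mem_nth //= szq; lia.
  wlog: x y xy / is_parent (join p q) x y.
    move=> H; have := xy; rewrite adj_parent_graph => /orP[/H|/H]; first exact.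
    by rewrite adj_sym xy => /(_ isT); rewrite ![(y \in _) && _]andbC.
  move=> /andP[lxy]; have [yp _|yp] := leqP y (size p).
    by rewrite !inA //; lia.
  (* A vertex numbered beyond [size p] has the root or another such vertex as its parent, so the
     edge stays on the second side. *)
  have yq : y < (size p + size q).+1 by rewrite -size_join.
  have -> : y.-1 = (y.-1 - size p) + size p by lia.
  rewrite nth_join_r; last lia.
  move=> ex; rewrite [X in _ || X](_ : _ = true) ?orbT //; apply/andP; split.
    apply: inB; move: ex => /eqP <-; case: (nth 0 q _ =P 0) => //= /eqP b0.
    by rewrite -[X in X < _]add0n ltn_add2r lt0n b0 orbT.
  by apply: inB; rewrite yp orbT.
- by rewrite inE mem_head.
- by rewrite inE mem_head.
- apply/subsetP => x; rewrite !inE => /andP[/orP[//|xp] /orP[//|xq]].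
  have /(nthP ord0)[i ip ex] := xp; have /(nthP ord0)[j jq ex'] := xq.
  have := vp i.+1; have := vq j.+1; rewrite /= ex ex' -szp -szq => h1 h2.
  move: (h1 jq) (h2 ip) => {h1 h2} /= -> e; exfalso; move: ip e.
  by move: (size sp); lia.
Qed.

Lemma tree_type_pow m p : tree_type (iter m (join p) [::]) =
  iter m (mu (tree_type p)) (ty1 V k).
Proof.
by elim: m => [|m IH]; rewrite ?tree_type0 // iterS tree_type_join IH.
Qed.

(** The types are treated one after another. For a type realised by a tree [p], gluing [m] copies of
    [p] to the current tree makes one further copy invisible by aperiodicity, and commutativity
    preserves what was absorbed before. *)
Lemma absorbing_tree : exists2 b, parents_ok b &
  forall p, parents_ok p -> mu (tree_type b) (tree_type p) = tree_type b.
Proof.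
have [m aper] := mu_aperiodic V k.
suff H (l : seq (ty V k)) : exists2 b, parents_ok b & forall p, parents_ok p ->
    tree_type p \in l -> mu (tree_type b) (tree_type p) = tree_type b.
  have [b hb H'] := H (enum (ty V k)); exists b => // p hp.
  by apply: H' => //; rewrite mem_enum.
elim: l => [|t l [b hb IH]]; first by exists [::].
have [[p hp pt]|no] := pselect (exists2 p, parents_ok p & tree_type p = t).
  exists (join b (iter m (join p) [::])).
    apply: parents_ok_join => //.
    elim: (m) => [|j IHj] //=; exact: parents_ok_join.
  move=> q hq; rewrite inE tree_type_join tree_type_pow => /orP[/eqP ->|ql].
    by rewrite -mu_assoc [mu (iter _ _ _) _]mu_comm -pt; congr mu; apply: aper.
  by rewrite -mu_assoc [mu (iter _ _ _) _]mu_comm mu_assoc IH.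
(* A type realised by no tree imposes no condition. *)
exists b => // q hq; rewrite inE => /orP[/eqP qt|]; last exact: IH.
by case: no; exists q.
Qed.

End TreeTypes.

(** * Trees under attachment of a vertex *)

Lemma enumerates_rcons (T : finType) (G : sgraph T) p u s x i :
  enumerates G p u s -> x \notin u :: s -> i <= size p ->
  {in u :: s, forall y, adj G y x = (y == nth u (u :: s) i)} ->
  enumerates G (rcons p i) u (rcons s x).
Proof.
move=> [us sz adjs] xs ip adjx; split.
- by rewrite -rcons_cons rcons_uniq xs.
- by rewrite !size_rcons sz.
move=> a b; rewrite size_rcons -rcons_cons => /andP[ab].
rewrite leq_eqVlt => /orP[/eqP bp|]; last first.
  move=> bp; rewrite !nth_rcons /= sz bp (ltn_trans ab bp).
  have -> : b.-1 < size p by case: (b) ab bp => // b' _; rewrite ltnS.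
  by apply: adjs; rewrite ab.
have lta : a < size (u :: s) by rewrite /= sz -bp.
rewrite !nth_rcons lta bp /= sz !ltnn !eqxx adjx ?mem_nth // nth_uniq //=.

by rewrite sz ltnS.
Qed.

Lemma enumerates_map (T T' : finType) (G : sgraph T) (G' : sgraph T')
    (f : T -> T') p u s : injective f ->
  (forall x y, adj G' (f x) (f y) = adj G x y) ->
  enumerates G p u s -> enumerates G' p (f u) (map f s).
Proof.
move=> injf adjf [us sz adjs]; split; rewrite ?size_map //.
  by rewrite -map_cons map_inj_uniq.
move=> a b /andP[ab bp]; rewrite -map_cons !(nth_map u) /= ?sz //; last lia.
by rewrite adjf adjs // ab.
Qed.

Lemma imset_set_seq (T T' : finType) (f : T -> T') (s : seq T) :
  f @: [set x in s] = [set x in map f s].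
Proof.
apply/setP => x; rewrite [RHS]inE.
by apply/imsetP/mapP => -[y ys ->]; exists y; move: ys; rewrite ?inE.
Qed.

Definition tree_on (T : finType) (G : sgraph T) (u : T) (A : {set T}) :=
  exists p s, [/\ parents_ok p, enumerates G p u s & A = [set x in u :: s]].

Section Attach.
Variables (n : nat) (G : sgraph 'I_n) (v : 'I_n).
Local Notation G' := (attach G v).
Local Notation old := (lift (@ord_max n)).

Lemma old_inj : injective old.
Proof. exact: lift_inj. Qed.

Lemma old_neq (x : 'I_n) : (old x == ord_max) = false.
Proof. by rewrite eq_sym; apply/negbTE/neq_lift. Qed.

Lemma mem_map_old (s : seq 'I_n) : (@ord_max n \in map old s) = false.
Proof. by apply/mapP => -[x _ /eqP]; rewrite eq_sym old_neq. Qed.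

Lemma adj_old x y : adj G' (old x) (old y) = adj G x y.
Proof. by rewrite /adj /= ffunE /attach_rel /= !liftK. Qed.

Lemma adj_new x : adj G' (old x) ord_max = (x == v).
Proof. by rewrite /adj /= ffunE /attach_rel /= liftK unlift_none. Qed.

Lemma degE m (H : sgraph 'I_m) x : deg H x = \sum_y adj H x y.
Proof.
rewrite /deg -sum1dep_card big_mkcond /=.
by apply: eq_bigr => y _; case: adj.
Qed.

Lemma deg_old x : deg G' (old x) = deg G x + (x == v).
Proof.
rewrite !degE (bigD1_ord ord_max) //= adj_new addnC; congr addn.
by apply: eq_bigr => y _; rewrite adj_old.
Qed.

Lemma deg_new : deg G' ord_max = 1.
Proof.
rewrite degE (bigD1_ord ord_max) //= adj_irr add0n (bigD1 v) //=.
rewrite adj_sym adj_new eqxx big1 // => y yv.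
by rewrite adj_sym adj_new (negPf yv).
Qed.

Lemma sum_deg_attach : \sum_x deg G' x = (\sum_x deg G x).+2.
Proof.
rewrite (bigD1_ord ord_max) //= deg_new.
under eq_bigr do rewrite deg_old.
rewrite big_split /= (_ : \sum_i (i == v) = 1) ?add1n ?addn1 //.
by rewrite (bigD1 v) //= eqxx big1 // => i /negPf ->.
Qed.

Lemma tree_on_old u A : tree_on G u A -> tree_on G' (old u) (old @: A).
Proof.
move=> [p [s [hp hs ->]]]; exists p, (map old s); split => //.
  by apply: enumerates_map hs; [exact: old_inj | exact: adj_old].
exact: (imset_set_seq _ (u :: s)).
Qed.

Lemma tree_on_attach u A : tree_on G u A -> v \in A ->
  tree_on G' (old u) (ord_max |: old @: A).
Proof.
move=> [p [s [hp hs ->]]]; rewrite inE => vs.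
have sz : size s = size p by case: hs.
exists (rcons p (index v (u :: s))), (rcons (map old s) ord_max); split.
- move=> i; rewrite size_rcons nth_rcons ltnS leq_eqVlt => /orP[/eqP ->|ip].
    by rewrite ltnn eqxx -sz -ltnS -[(size s).+1]/(size (u :: s)) index_mem.
  by rewrite ip hp.
- apply: enumerates_rcons.
  + by apply: enumerates_map hs; [exact: old_inj | exact: adj_old].
  + by rewrite -map_cons mem_map_old.
  + by rewrite -sz -ltnS -[(size s).+1]/(size (u :: s)) index_mem.
  rewrite -map_cons => _ /mapP[y ys ->].
  by rewrite adj_new (nth_map u) ?index_mem // nth_index // (inj_eq old_inj).
- rewrite imset_set_seq; apply/setP => x.
  by rewrite /= in_setU1 !in_set !in_cons mem_rcons in_cons orbCA.
Qed.

(** The new leaf becomes the root with [v] as its only child, so the tree rooted at [v] is shifted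
    by one position. *)
Lemma tree_on_new : tree_on G v [set: 'I_n] ->
  tree_on G' ord_max [set: 'I_n.+1].
Proof.
move=> [p [s [hp [us sz adjs] es]]].
exists (0 :: map S p), (old v :: map old s); split.
- move=> [|i] //=; rewrite size_map ltnS => ip.
  by rewrite (nth_map 0) // ltnS hp.
- split.
  + by rewrite cons_uniq -map_cons mem_map_old map_inj_uniq //; exact: old_inj.
  + by rewrite /= !size_map sz.
  rewrite /= size_map => a [//|b] /andP[]; rewrite !ltnS => ab bp.
  have nthS i : i <= size p -> nth ord_max (ord_max :: old v :: map old s) i.+1 =
      old (nth v (v :: s) i).
    by move=> ip; rewrite -[LHS]/(nth _ (map old (v :: s)) i) (nth_map v) //= sz.
  rewrite nthS //; case: a ab => [|a] ab.
    rewrite adj_sym adj_new; case: b ab bp => [|b] _ bp /=; first by rewrite eqxx.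
    rewrite (nth_map 0) //; apply/negbTE; move: us => /= /andP[vs _].
    by apply: contra vs => /eqP <-; rewrite mem_nth // sz.
  rewrite nthS; last lia.
  rewrite adj_old adjs; last lia.
  by case: b ab bp => // b ab bp /=; rewrite (nth_map 0) // eqSS.
- apply/setP => x; rewrite inE; apply/esym; case: (unliftP ord_max x) => [y ->|->].
    rewrite in_set in_cons old_neq /= -[_ :: _]/(map old (v :: s)).
    rewrite mem_map; last exact: old_inj.
    by have := in_setT y; rewrite es in_set.
  by rewrite in_set mem_head.
Qed.

End Attach.

(** The tree property is stated for every root, since a copy may be started at any vertex and since
    re-rooting at a new leaf uses the tree rooted at its neighbour. *)
Definition pa_tree n (G : sgraph 'I_n) :=
  [/\ \sum_v deg G v = 2 * n.-1, forall v, 0 < deg G v &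
      forall u, tree_on G u [set: 'I_n]].

Lemma pa_tree_attach n (G : sgraph 'I_n.+1) v :
  pa_tree G -> pa_tree (attach G v).
Proof.
move=> [sd pd tr]; split; first by rewrite sum_deg_attach sd; lia.
  move=> x; case: (unliftP ord_max x) => [y ->|->]; rewrite ?deg_new //.
  by rewrite deg_old ltn_addr.
move=> x; case: (unliftP ord_max x) => [y ->|->]; last exact/tree_on_new.
have -> : [set: 'I_n.+2] = ord_max |: lift ord_max @: [set: 'I_n.+1].
  apply/setP => z; rewrite !inE; case: (unliftP ord_max z) => [w ->|->].
    by rewrite imset_f ?orbT.
  by rewrite eqxx.
by apply: tree_on_attach; [exact: tr | exact: in_setT].
Qed.

Lemma pa_tree_complete2 : pa_tree (complete 'I_2).
Proof.
have adjE x y : adj (complete 'I_2) x y = (x != y) by rewrite /adj ffunE.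
have degE2 x : deg (complete 'I_2) x = 1.
  rewrite degE (bigD1 x) //= adjE eqxx (eq_bigr (fun=> 1)).
    by rewrite sum1_card cardC1 card_ord.
  by move=> y yx; rewrite adjE eq_sym yx.
split.
- by rewrite (eq_bigr (fun=> 1)) ?sum1_card ?card_ord.
- by move=> v; rewrite degE2.
move=> u; pose w : 'I_2 := if u == ord0 then ord_max else ord0.
have uw : u != w by rewrite /w; case: (eqVneq u ord0) => // ->.
exists [:: 0], [:: w]; split=> //; first by case.
  split=> //; first by rewrite /= inE uw.
  move=> a c h; have [-> ->] : a = 0 /\ c = 1 by move: h => /=; lia.
  by rewrite adjE uw.
apply/setP => x; rewrite !inE; move: uw; rewrite -!val_eqE /=.
by have := ltn_ord x; have := ltn_ord u; have := ltn_ord w; lia.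
Qed.

(** * Growth of copies of a fixed tree *)

Section Copies.
Variable b : seq nat.
Hypothesis b_ok : parents_ok b.

(* [(u, s)] is a copy of the first [size s] vertices of [b] below [u], detached
   from the rest of the graph except at [u]. *)
Definition copy_ok n (G : sgraph 'I_n) (c : 'I_n * seq 'I_n) :=
  [/\ size c.2 <= size b, enumerates G (take (size c.2) b) c.1 c.2,
      {in c.2, forall x y, adj G x y -> y \in c.1 :: c.2},
      tree_on G c.1 (~: [set x in c.2]) & deg G c.1 <= size c.2 + 4].

Definition next_vertex n (c : 'I_n * seq 'I_n) : 'I_n :=
  nth c.1 (c.1 :: c.2) (nth 0 b (size c.2)).

Definition extends n (v : 'I_n) (c : 'I_n * seq 'I_n) : bool :=
  (size c.2 < size b) && (v == next_vertex c).

(** [None] is a dead copy. A hit inside the copy is fatal unless it falls on the prescribed vertex;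
    once the copy is complete, every hit is fatal. *)
Definition step n (v : 'I_n) (c : 'I_n * seq 'I_n) :
    option ('I_n.+1 * seq 'I_n.+1) :=
  let c' := (lift ord_max c.1, map (lift ord_max) c.2) in
  if v \notin c.1 :: c.2 then Some c'
  else if extends v c then Some (c'.1, rcons c'.2 ord_max) else None.

Lemma next_vertex_mem n (c : 'I_n * seq 'I_n) : size c.2 < size b ->
  next_vertex c \in c.1 :: c.2.
Proof. by move=> h; rewrite mem_nth // /= ltnS b_ok. Qed.

Lemma copy_ok_keep n (G : sgraph 'I_n) v c : copy_ok G c -> v \notin c.1 :: c.2 ->
  copy_ok (attach G v) (lift ord_max c.1, map (lift ord_max) c.2).
Proof.
move=> [szb en cl tr dg] vc; split; rewrite /= ?size_map //.
- by apply: enumerates_map en; [exact: old_inj | exact: adj_old].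
- move=> _ /mapP[x xs ->] y; case: (unliftP ord_max y) => [z ->|->].
    rewrite adj_old => /(cl _ xs) zin.
    by rewrite -map_cons mem_map //; exact: old_inj.
  rewrite adj_new => /eqP xv; move: vc; by rewrite -xv inE xs orbT.
- have -> : ~: [set x in map (lift ord_max) c.2] =
      @ord_max n |: lift ord_max @: (~: [set x in c.2]).
    apply/setP => x; rewrite !inE; case: (unliftP ord_max x) => [y ->|->].
      rewrite old_neq /= mem_map ?(mem_imset _ _ (@old_inj n)) ?inE //.
      exact: old_inj.
    by rewrite mem_map_old eqxx.
  by apply: tree_on_attach => //; rewrite !inE; move: vc; rewrite inE => /norP[].
- rewrite deg_old; move: vc; rewrite inE eq_sym => /norP[/negPf -> _].
  by rewrite addn0.
Qed.

Lemma copy_ok_extend n (G : sgraph 'I_n) v c : copy_ok G c -> extends v c ->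
  copy_ok (attach G v)
    (lift ord_max c.1, rcons (map (lift ord_max) c.2) ord_max).
Proof.
move=> [szb en cl tr dg] /andP[lt /eqP ev].
split; rewrite /= ?size_rcons ?size_map //.
- rewrite (take_nth 0) //; apply: enumerates_rcons.
  + by apply: enumerates_map en; [exact: old_inj | exact: adj_old].
  + by rewrite -map_cons mem_map_old.
  + by rewrite size_take lt b_ok.
  rewrite -map_cons => _ /mapP[y ys ->].
  rewrite adj_new (nth_map c.1) /= ?ltnS ?b_ok // (inj_eq (@old_inj n)) ev.
  by [].
- move=> x; rewrite mem_rcons inE => /orP[/eqP -> | /mapP[{}x xs ->]] y.
    case: (unliftP ord_max y) => [z ->|->]; last by rewrite adj_irr.
    rewrite adj_sym adj_new => /eqP ->; rewrite -rcons_cons mem_rcons inE.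
    rewrite -map_cons mem_map ?ev ?next_vertex_mem ?orbT //; exact: old_inj.
  rewrite -rcons_cons mem_rcons inE.
  case: (unliftP ord_max y) => [z ->|->]; last by rewrite eqxx.
  rewrite adj_old => /(cl _ xs) zin.
  by rewrite -map_cons mem_map ?zin ?orbT //; exact: old_inj.
(* The new vertex belongs to the copy, so the rest of the graph is unchanged. *)
- have -> : ~: [set x in rcons (map (lift ord_max) c.2) ord_max] =
      lift (@ord_max n) @: (~: [set x in c.2]).
    apply/setP => x; rewrite !inE mem_rcons inE.
    case: (unliftP ord_max x) => [y ->|->].
      rewrite old_neq /= mem_map ?(mem_imset _ _ (@old_inj n)) ?inE //.
      exact: old_inj.
    by rewrite eqxx; apply/esym/imsetP => -[y _ /eqP]; rewrite eq_sym old_neq.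
  exact: tree_on_old.
(* The root gains at most one neighbour while the list grows by one. *)
- by rewrite deg_old addSn -[X in _ <= X]addn1 leq_add // leq_b1.
Qed.

Lemma step_ok n (G : sgraph 'I_n) v c c' :
  copy_ok G c -> step v c = Some c' -> copy_ok (attach G v) c'.
Proof.
move=> ok; rewrite /step; case: ifP => [vc [<-]|_]; first exact: copy_ok_keep.
by case: ifP => // ex [<-]; exact: copy_ok_extend.
Qed.

Definition elems n (o : option ('I_n * seq 'I_n)) : seq 'I_n :=
  if o is Some c then c.1 :: c.2 else [::].

(** With [elems_step_new], this keeps distinct copies disjoint: an old vertex never enters a copy,
    and the new vertex enters only a copy containing its neighbour [v]. *)
Lemma elems_step_old n (v : 'I_n) o x :
  lift ord_max x \in elems (obind (step v) o) -> x \in elems o.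
Proof.
case: o => //= c; rewrite /step; case: ifP => _.
  by rewrite /= -map_cons mem_map //; exact: old_inj.
case: ifP => //= _.
rewrite -rcons_cons mem_rcons inE old_neq -map_cons mem_map //.
exact: old_inj.
Qed.

Lemma elems_step_new n (v : 'I_n) o :
  ord_max \in elems (obind (step v) o) -> v \in elems o.
Proof.
case: o => //= c; rewrite /step; case: ifP => [_|/negbFE -> //].
by rewrite /= -map_cons mem_map_old.
Qed.

Lemma tp_full_copy V k n (G : sgraph 'I_n) c :
  (forall p, parents_ok p ->
     mu (tree_type V k b) (tree_type V k p) = tree_type V k b) ->
  copy_ok G c -> size c.2 = size b ->
  tp V k G [set: 'I_n] c.1 (fun=> set0) = tree_type V k b.
Proof.
move=> absb [_ en cl [p [s [hp ep es]]] _] sz; rewrite sz take_size in en.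
rewrite -(absb _ hp) -(tp_enumerates V k en) -(tp_enumerates V k ep) -es -tp_merge.
- congr tp; apply/esym/setP => x; rewrite !inE.
  by case: (x \in c.2); rewrite ?orbT.
- move=> x y _ _; rewrite !inE => xy.
  case xs: (x \in c.2).
    by rewrite -[(y == c.1) || _]in_cons (cl x) // orbT.
  case ys: (y \in c.2); last by rewrite orbT.
  have := cl y ys x; rewrite adj_sym => /(_ xy).
  by rewrite inE xs => ->; rewrite orbT.
- by rewrite inE mem_head.
- by rewrite es inE mem_head.
- apply/subsetP => x; rewrite !inE => /andP[/orP[//|xc]].
  by rewrite xc.
Qed.

End Copies.

Local Open Scope ring_scope.

(** * The attachment law as a Markov chain *)

Section Law.
Variable R : realType.

Definition attach_prob n (G : sgraph 'I_n) (v : 'I_n) : R :=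
  (deg G v)%:R / (2 * n.-1)%:R.

Lemma attach_prob_ge0 n (G : sgraph 'I_n) v : 0 <= attach_prob G v.
Proof. by rewrite divr_ge0. Qed.

Lemma sum_attach_prob n (G : sgraph 'I_n) : (1 < n)%N -> pa_tree G ->
  \sum_v attach_prob G v = 1.
Proof.
move=> n1 [sd _ _]; rewrite -mulr_suml -natr_sum sd divff // pnatr_eq0.
by rewrite muln_eq0 /= -lt0n -ltnS prednK // ltnW.
Qed.

(** Exchanging the sums turns the recursion for the law into a conditional expectation over one
    attachment step. *)
Lemma pa_law_step k (F : sgraph 'I_k.+3 -> R) :
  \sum_(G : sgraph 'I_k.+3) pa_law R G * F G =
  \sum_(G : sgraph 'I_k.+2) pa_law R G *
    \sum_v attach_prob G v * F (attach G v).
Proof.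
transitivity (\sum_(G' : sgraph 'I_k.+3) \sum_(G : sgraph 'I_k.+2)
    pa_law R G * \sum_(v | attach G v == G') attach_prob G v * F G').
  by apply: eq_bigr => G' _; rewrite [pa_law _ _]/= mulr_suml;
    apply: eq_bigr => G _; rewrite -mulrA -mulr_suml.
rewrite exchange_big /=; apply: eq_bigr => G _.
rewrite -mulr_sumr; congr (_ * _).
rewrite (exchange_big_dep xpredT) //=; apply: eq_bigr => v _.
by rewrite (big_pred1 (attach G v)) // => G'; rewrite eq_sym.
Qed.

Lemma pa_law_ge0 k (G : sgraph 'I_k.+2) : 0 <= pa_law R G.
Proof.
elim: k G => [|k IH] G; first by rewrite /= ler0n.
apply: sumr_ge0 => G0 _; by rewrite mulr_ge0 // sumr_ge0.
Qed.

Lemma pa_law_support k (G : sgraph 'I_k.+2) : pa_law R G != 0 -> pa_tree G.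
Proof.
elim: k G => [|k IH] G /=.
  case: (G =P complete 'I_2) => [-> _|_]; first exact: pa_tree_complete2.
  by rewrite eqxx.
move=> /eqP nz; apply: contrapT => H; apply: nz; apply: big1 => G0 _.
have [->|/IH tG0] := eqVneq (pa_law R G0) 0; first by rewrite mul0r.
rewrite big1 ?mulr0 // => v /eqP e; case: H; rewrite -e; exact: pa_tree_attach.
Qed.

Lemma pa_law_sum k : \sum_(G : sgraph 'I_k.+2) pa_law R G = 1.
Proof.
elim: k => [|k IH].
  by rewrite (bigD1 (complete 'I_2)) //= eqxx big1 ?addr0 // => G /negPf ->.
transitivity (\sum_(G : sgraph 'I_k.+3) pa_law R G * 1).
  by apply: eq_bigr => G _; rewrite mulr1.
rewrite (pa_law_step (fun=> 1)) -[RHS]IH; apply: eq_bigr => G _.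
have [->|/pa_law_support tG] := eqVneq (pa_law R G) 0; first by rewrite mul0r.
rewrite (eq_bigr (attach_prob G)) ?sum_attach_prob ?mulr1 // => v _.
by rewrite /= mulr1.
Qed.

Lemma ler_pa_law k (F H : sgraph 'I_k.+2 -> R) :
  (forall G, pa_tree G -> F G <= H G) ->
  \sum_G pa_law R G * F G <= \sum_G pa_law R G * H G.
Proof.
move=> FH; apply: ler_sum => G _.
have [->|/pa_law_support tG] := eqVneq (pa_law R G) 0; first by rewrite !mul0r.
by rewrite ler_wpM2l ?pa_law_ge0 // FH.
Qed.

End Law.

(** * Real inequalities and the gain recursion *)

Section Real.
Variable R : realType.

(** At most one [d i] is nonzero, so all cross terms vanish. This is the situation of one new edge
    and disjoint copies. *)
Lemma prod_1D_single (K : nat) (d : 'I_K -> R) :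
  (forall i j, i != j -> d i = 0 \/ d j = 0) ->
  \prod_i (1 + d i) = 1 + \sum_i d i.
Proof.
move=> h; have [/existsP[i di]|/existsPn no] := boolP [exists i, d i != 0].
  have dj j : j != i -> d j = 0.
    by move=> ji; case: (h j i ji) => // /eqP; rewrite (negPf di).
  rewrite (bigD1 i) // [in RHS](bigD1 i) //= !big1 ?mulr1 ?addr0 // => j /dj //.
  by move=> ->; rewrite addr0.
have d0 i : d i = 0 by apply/eqP; have := no i; rewrite negbK.
by rewrite !big1 ?addr0 // => i _; rewrite d0 ?addr0.
Qed.

(* The first-order change of [1 - g] over one step is [w g - q h] with
   [w <= W eps] and [q >= eps]; doubling [W] and halving [eps] pays for the
   second-order terms. *)
Lemma one_step_bound (g h w q W eps : R) :
  0 <= g <= 1 / 2 -> 0 <= h <= 1 / 2 -> 0 < eps -> 0 <= W -> 1 <= W ->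
  W * eps <= 1 / 2 -> w <= W * eps -> eps <= q \/ h = 0 ->
  (1 - g) * expR ((w * g - q * h) / (1 - g)) <=
  1 - ((1 - 2 * W * eps) * g + eps / 2 * h).
Proof.
move=> /andP[g0 g1] /andP[h0 h1] e0 W0 W1 We wW qe.
have A0 : 0 < 1 - g by lra.
set y0 : R := eps * (W * g - h) / (1 - g).
have qh : eps * h <= q * h by case: qe => [?|->]; [exact: ler_wpM2r | lra].
have wg : w * g <= W * eps * g by exact: ler_wpM2r.
have leW : eps <= W * eps by rewrite ler_peMl // ltW.
have a4 : W * eps * g <= 1 / 4.
  have : W * eps * g <= 1 / 2 * (1 / 2) by apply: ler_pM => //; nra.
  lra.
have a0 : 0 <= W * eps * g by nra.
have eh : eps * h <= 1 / 4.
  have : eps * h <= 1 / 2 * (1 / 2) by apply: ler_pM; lra.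
  lra.
have eh0 : 0 <= eps * h by nra.
have le1 : expR ((w * g - q * h) / (1 - g)) <= expR y0.
  rewrite ler_expR ler_pM2r ?invr_gt0 //; lra.
have den : 0 < 1 - g - eps * (W * g - h) by lra.
(* The bound [expR y <= 1 / (1 - y)], from [1 - y <= expR (- y)], makes the inequality rational. *)
have le2 : expR y0 <= (1 - g) / (1 - g - eps * (W * g - h)).
  have y1 : 1 - y0 = (1 - g - eps * (W * g - h)) / (1 - g).
    by rewrite /y0; field; lra.
  have : 1 + - y0 <= expR (- y0) by exact: expR_ge1Dx.
  rewrite expRN y1 => le; rewrite -[expR y0]invrK -[X in _ <= X]invrK lef_pV2.
  - by rewrite invf_div.
  - by rewrite posrE invr_gt0 expR_gt0.
  - by rewrite posrE invr_gt0 divr_gt0.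
apply: (le_trans (ler_wpM2l (ltW A0) (le_trans le1 le2))).
rewrite mulrA ler_pdivrMr //.
(* With [A = 1 - g], what remains is [A ^+ 2 <= (A + 2 * a - e / 2) * (A - a + e)]. The linear terms
   [A * (a + e / 2)] outweigh the quadratic ones because [A >= 1 / 2] and [a, e <= 1 / 4]. *)
set a := W * eps * g in a4 a0 *; set e := eps * h in eh eh0 *.
have -> : eps * (W * g - h) = a - e by rewrite /a /e; ring.
have -> : (1 - 2 * W * eps) * g + eps / 2 * h = g - 2 * a + e / 2.
  by rewrite /a /e; field.
clearbody a e; nra.
Qed.

Lemma bernoulli_le (x : R) m : 0 <= x <= 1 -> 1 - m%:R * x <= (1 - x) ^+ m.
Proof.
move=> /andP[x0 x1]; elim: m => [|m IH]; first by rewrite expr0 mul0r subr0.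
rewrite exprS; apply: le_trans (ler_wpM2l _ IH); last by lra.
have : 0 <= m%:R * x * x by rewrite !mulr_ge0.
by rewrite -natr1; lra.
Qed.

Lemma expn_le_ffact m i : ((m - i) ^ i <= m ^_ i)%N.
Proof.
elim: i m => [|i IH] m; first by rewrite ffactn0.
rewrite expnS ffactnS leq_mul ?leq_subr //.
by rewrite -subn1 -[i.+1]add1n subnDA.
Qed.

End Real.

Section Descent.
Variables (R : realType) (W eps : R).

(* [gain m i] bounds from below the decrease from [1] of the factor contributed
   by a copy with [m] steps to go and [i] vertices missing. *)
Fixpoint gain (m i : nat) : R :=
  match m with
  | 0 => if i == 0%N then 1 / 2 else 0
  | m'.+1 => (1 - 2 * W * eps) * gain m' i +
             eps / 2 * (if i is i'.+1 then gain m' i' else 0)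
  end.

Lemma gain_bounds m i : 0 < eps -> 1 <= W -> W * eps <= 1 / 2 ->
  0 <= gain m i <= 1 / 2.
Proof.
move=> eps0 W1 We.
have e1 : eps <= W * eps by rewrite ler_peMl // ltW.
elim: m i => [|m IH] i; first by case: i => [|i] /=; apply/andP; split; lra.
have /andP[g0 g1] := IH i; rewrite /=.
have /andP[h0 h1] : 0 <= (if i is i'.+1 then gain m i' else 0) <= 1 / 2.
  by case: i {g0 g1} => [|i]; [apply/andP; split; lra | exact: IH].
set g := gain m i in g0 g1 *.
set h : R := (if i is _.+1 then _ else _) in h0 h1 *.
clearbody g h.
have : 0 <= (1 - 2 * W * eps) * g by apply: mulr_ge0; lra.
have : (1 - 2 * W * eps) * g <= (1 - 2 * W * eps) * (1 / 2).
  by apply: ler_wpM2l; lra.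
have : 0 <= eps * h by rewrite mulr_ge0 // ltW.
have : eps * h <= eps * (1 / 2) by rewrite ler_wpM2l // ltW.
by move=> *; apply/andP; split; lra.
Qed.

(** Unfolding the recursion chooses which [i] of the [m] steps add a vertex, each with a factor
    [eps / 2]; every other step has a factor [1 - 2 * W * eps]. As the latter is at most 1, its
    power [m - i] may be replaced by [m]. *)
Lemma gain_ge m i : 0 < eps -> 1 <= W -> W * eps <= 1 / 2 ->
  1 / 2 * (1 - 2 * W * eps) ^+ m * 'C(m, i)%:R * (eps / 2) ^+ i <= gain m i.
Proof.
move=> eps0 W1 We.
have l0 : 0 <= 1 - 2 * W * eps by lra.
have l1 : 1 - 2 * W * eps <= 1.
  by have := mulr_ge0 (le_trans ler01 W1) (ltW eps0); lra.
elim: m i => [|m IH] [|i] /=.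
- by rewrite expr0 bin0 !mulr1.
- by rewrite bin0n mulr0 mul0r.
- have := ler_wpM2l l0 (IH 0%N); rewrite !bin0 !expr0 exprS; lra.
- have h1 := ler_wpM2l l0 (IH i.+1).
  have h2 : 0 <= eps / 2 by lra.
  have h3 := ler_wpM2l h2 (IH i).
  apply: le_trans (lerD h1 h3); rewrite binS natrD !exprS.
  set l := 1 - _ in l0 l1 *; set x := l ^+ m; set q := eps / 2 in h2 *.
  set y := q ^+ i.
  have x0 : 0 <= x by exact: exprn_ge0.
  have y0 : 0 <= y by exact: exprn_ge0.
  have p0 := mulr_ge0 (mulr_ge0 x0 (ler0n R 'C(m, i))) (mulr_ge0 h2 y0).
  have := ler_wpM2r p0 l1; rewrite /=; lra.
Qed.

End Descent.

Local Open Scope ring_scope.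

(** * The supermartingale bound *)

Section Miss.
Variables (R : realType) (b : seq nat).
Hypothesis b_ok : parents_ok b.

Definition has_copy n (G : sgraph 'I_n) : Prop :=
  exists2 c, copy_ok b G c & size c.2 = size b.

Fixpoint miss_prob (m : nat) : forall n, sgraph 'I_n -> R :=
  match m with
  | 0 => fun n G => (~~ `[< has_copy G >])%:R
  | m'.+1 => fun n G => \sum_v attach_prob R G v * miss_prob m' (attach G v)
  end.

Lemma pa_law_miss m k j :
  \sum_(G : sgraph 'I_(m + k).+2) pa_law R G * miss_prob j G =
  \sum_(G : sgraph 'I_k.+2) pa_law R G * miss_prob (m + j) G.
Proof.
elim: m j => [|m IH] j //.
by rewrite (pa_law_step (@miss_prob j _)) (IH j.+1) addnS.
Qed.

Variables (N : nat) (W : R).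
(** At each step up to time [N] a given vertex is hit with probability at least [eps], and, once
    [N <= 2 * n.-1], a given copy is hit with probability at most [W * eps]. *)
Let eps : R := (2 * N)%:R^-1.
Hypothesis N0 : (0 < N)%N.
Hypothesis WE : W = (2 * ((size b).+1 * (size b + 4)))%:R.
Hypothesis WN : W * eps <= 1 / 2.

Let eps0 : 0 < eps. Proof. by rewrite invr_gt0 ltr0n muln_gt0. Qed.
Let W1 : 1 <= W. Proof. by rewrite WE ler1n !muln_gt0 /= addn4. Qed.

Notation gain := (gain W eps).

(** A dead copy has weight 1, as if its gain were zero. *)
Definition factor m n (o : option ('I_n * seq 'I_n)) : R :=
  if o is Some c then 1 - gain m (size b - size c.2) else 1.

Lemma factor_gt0 m n (o : option ('I_n * seq 'I_n)) : 0 < factor m o.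
Proof.
case: o => //= c.
by have /andP[_ le] := gain_bounds m (size b - size c.2) eps0 W1 WN; lra.
Qed.

(** A hit forfeits the current gain; a hit at the prescribed vertex replaces it by the gain with one
    vertex fewer missing. *)
Lemma factor_step m n (v : 'I_n) c :
  factor m (step b v c) - factor m (Some c) =
  (v \in c.1 :: c.2)%:R * gain m (size b - size c.2) -
  (extends b v c)%:R *
    (if (size b - size c.2)%N is i.+1 then gain m i else 0).
Proof.
rewrite /step; case: ifP => [vc|/negbFE vc].
  rewrite /= size_map (negPf vc) (_ : extends b v c = false).
    by rewrite !mul0r !subrr.
  by apply: contraNF vc => /andP[lt /eqP ->]; exact: next_vertex_mem.
rewrite vc mul1r; case: ifP => [/andP[lt _] | _] /=; last by rewrite mul0r; ring.
rewrite mul1r size_rcons size_map.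
case e : (size b - size c.2)%N => [|i]; first lia.
have -> : (size b - (size c.2).+1 = i)%N by lia.
by ring.
Qed.

Section OneStep.
Variables (m n : nat) (G : sgraph 'I_n).
Hypotheses (nN : (N <= 2 * n.-1)%N) (n_le : (n <= N)%N) (n1 : (1 < n)%N).
Hypothesis treeG : pa_tree G.

Definition rel_change (o : option ('I_n * seq 'I_n)) (v : 'I_n) : R :=
  factor m (obind (step b v) o) / factor m o - 1.

Lemma rel_change0 o v : v \notin elems o -> rel_change o v = 0.
Proof.
rewrite /rel_change; case: o => [c|] /= vc; last by rewrite divr1 subrr.
have : factor m (step b v c) - factor m (Some c) = 0.
  rewrite factor_step (negPf vc) mul0r (_ : extends b v c = false).
    by rewrite mul0r subr0.
  by apply: contraNF vc => /andP[lt /eqP ->]; exact: next_vertex_mem.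
move/eqP; rewrite subr_eq0 => /eqP /= ->.
by rewrite divff ?subrr // gt_eqF ?(@factor_gt0 m n (Some c)).
Qed.

(** The root has degree at most [size b + 4], and the neighbours of any other vertex of the copy lie
    in the copy, so the total degree is bounded in terms of [b] alone. *)
Lemma copy_weight c : copy_ok b G c ->
  \sum_(v | v \in c.1 :: c.2) attach_prob R G v <= W * eps.
Proof.
move=> [szb en cl _ dg].
have n2 : (0 < 2 * n.-1)%N by case: (n) n1 => [|[]].
rewrite -mulr_suml ler_pdivrMr ?ltr0n // -natr_sum.
have dle v : v \in c.1 :: c.2 -> (deg G v <= size b + 4)%N.
  rewrite inE => /orP[/eqP ->|vc]; first by apply: leq_trans dg _; lia.
  apply: (@leq_trans (size (c.1 :: c.2))); last by rewrite /=; lia.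
  apply: (@leq_trans #|c.1 :: c.2|); last exact: card_size.
  apply/subset_leq_card/subsetP => w.
  by rewrite inE; exact: cl.
have le1 : (\sum_(v in c.1 :: c.2) deg G v <= (size b).+1 * (size b + 4))%N.
  apply: (@leq_trans (\sum_(v in c.1 :: c.2) (size b + 4)%N)).
    by apply: leq_sum => v; exact: dle.
  rewrite sum_nat_const leq_mul2r; apply/orP; right.
  by apply: leq_trans (card_size _) _.
rewrite WE /eps mulrAC ler_pdivlMr ?ltr0n ?muln_gt0 //.
rewrite -!natrM ler_nat; move: le1 nN.
set S := (\sum_(v in _) _)%N; set D := (_.+1 * _)%N => SD le.
have := leq_mul SD le; lia.
Qed.

(** With [w] the probability of hitting the copy and [q] that of hitting the prescribed vertex, the
    mean relative change is [(w * g - q * h) / (1 - g)], as in [one_step_bound]. *)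
Lemma factor_descent o : (forall c, o = Some c -> copy_ok b G c) ->
  factor m o * expR (\sum_v attach_prob R G v * rel_change o v) <= factor m.+1 o.
Proof.
case: o => [c|] ok; last first.
  by rewrite big1 ?expR0 ?mulr1 // => v _; rewrite rel_change0 ?mulr0.
have {ok} okc := ok c erefl.
set i := (size b - size c.2)%N; set g := gain m i.
set h : R := if i is i'.+1 then gain m i' else 0.
have f0 : 0 < 1 - g by exact: (@factor_gt0 m n (Some c)).
set w := \sum_(v | v \in c.1 :: c.2) attach_prob R G v.
pose q : R := attach_prob R G (next_vertex b c).
have -> : \sum_v attach_prob R G v * rel_change (Some c) v =
    (w * g - q * h) / (1 - g).
  have -> : (w * g - q * h) / (1 - g) = \sum_v attach_prob R G v *
      ((v \in c.1 :: c.2)%:R * g - (extends b v c)%:R * h) / (1 - g).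
    rewrite -mulr_suml; congr (_ / _).
    under eq_bigr do rewrite mulrBr; rewrite big_split /=; congr (_ + _).
      rewrite /w big_mkcond /= mulr_suml; apply: eq_bigr => v _.
      by case: (v \in _); rewrite ?mul1r // !mul0r mulr0.
    rewrite sumrN; congr (- _).
    have [lt|ge] := ltnP (size c.2) (size b); last first.
      have -> : h = 0 by rewrite /h /i; move: ge; rewrite -subn_eq0 => /eqP ->.
      by rewrite mulr0 big1 // => v _; rewrite !mulr0.
    rewrite (bigD1 (next_vertex b c)) //= big1 ?addr0.
      by rewrite /extends lt eqxx mul1r.
    by move=> v /negPf nv; rewrite /extends lt nv mul0r mulr0.
  apply: eq_bigr => v _; rewrite -factor_step /rel_change /= -/g -mulrA.
  by congr (_ * _); rewrite mulrBl divff // gt_eqF.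
have -> : factor m.+1 (Some c) =
  1 - ((1 - 2 * W * eps) * g + eps / 2 * h) by [].
apply: one_step_bound => //.
- exact: gain_bounds.
- rewrite /h; case: (i) => [|j]; last exact: gain_bounds.
  by apply/andP; split; lra.
- exact: le_trans ler01 W1.
- exact: copy_weight.
(* All degrees are positive, so the prescribed vertex is hit with probability at least [eps]; for a
   complete copy [h] is 0. *)
- have [lt|ge] := ltnP (size c.2) (size b); [left | right]; last first.
    by rewrite /h /i; move: ge; rewrite -subn_eq0 => /eqP ->.
  have [_ /(_ (next_vertex b c)) d0 _] := treeG.
  rewrite /q /attach_prob ler_pdivlMr; last first.
    by rewrite ltr0n; case: (n) n1 => [|[]].
  rewrite mulrC ler_pdivrMr ?ltr0n ?muln_gt0 // -natrM ler_nat.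
  apply: (@leq_trans (1 * (2 * N))); first by move: n_le n1; lia.
  exact: leq_mul.
Qed.

End OneStep.

Lemma miss_prob_le m n (G : sgraph 'I_n) K
    (c : 'I_K -> option ('I_n * seq 'I_n)) :
  (1 < n)%N -> (N <= 2 * n.-1)%N -> (n + m = N)%N -> pa_tree G ->
  (forall i c0, c i = Some c0 -> copy_ok b G c0) ->
  (forall i j x, i != j -> x \in elems (c i) -> x \notin elems (c j)) ->
  miss_prob m G <= \prod_i factor m (c i).
Proof.
elim: m n G c => [|m IH] n G c n1 nN nm tG ok dis /=.
  case: (asboolP (has_copy G)) => [_|no] /=.
    by apply: prodr_ge0 => i _; apply/ltW/factor_gt0.
  (* With no steps left, only a complete copy has a factor other than 1. *)
  rewrite big1 // => i _; case ci : (c i) => [c0|] //=.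
  have [szb _ _ _ _] := ok _ _ ci.
  case: eqP => [e|_]; last by rewrite subr0.
  by case: no; exists c0; [exact: ok ci | lia].
have n0 : (0 < n)%N by exact: ltnW.
have step1 v :
    miss_prob m (attach G v) <= \prod_i factor m (obind (step b v) (c i)).
  apply: IH; rewrite ?ltnS //.
  - lia.
  - lia.
  - case: (n) n0 G v tG {c ok dis nN n1 nm} => // n' _ G v.
    exact: pa_tree_attach.
  - move=> i c0; case ci: (c i) => [c1|] //=; apply: step_ok => //; exact: ok ci.
  move=> i j x ij xi; apply/negP => xj.
  case: (unliftP ord_max x) xi xj => [y ->|->].
    by move=> /elems_step_old yi /elems_step_old; apply/negP/(dis _ _ _ ij).
  by move=> /elems_step_new yi /elems_step_new; apply/negP/(dis _ _ _ ij).
set F := \prod_i factor m (c i).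
have F0 : 0 <= F by apply: prodr_ge0 => i _; apply/ltW/factor_gt0.
(* The new edge meets at most one copy, so the product is multiplied by 1 plus the sum of the
   relative changes; the middle term is the mean over [v]. *)
apply: le_trans (_ : F *
  (1 + \sum_i \sum_v attach_prob R G v * rel_change m (c i) v) <= _).
  rewrite exchange_big /= mulrDr mulr1 -[X in X + _]mulr1.
  rewrite -(sum_attach_prob R n1 tG) mulr_sumr mulr_sumr -big_split /=.
  apply: ler_sum => v _; rewrite -mulr_sumr.
  have -> : F * attach_prob R G v +
      F * (attach_prob R G v * \sum_i rel_change m (c i) v) =
    attach_prob R G v * (F * (1 + \sum_i rel_change m (c i) v)) by ring.
  apply: ler_wpM2l; first exact: attach_prob_ge0.
  apply: le_trans (step1 v) _; rewrite -prod_1D_single.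
    rewrite /F -big_split /= ler_prod // => i _.
    rewrite /rel_change addrC subrK mulrC.
    rewrite divfK ?lexx ?andbT ?gt_eqF ?factor_gt0 //.
    exact/ltW/factor_gt0.
  move=> i j ij; have [vi|vi] := boolP (v \in elems (c i)).
    by right; apply/rel_change0/(dis i).
  by left; apply/rel_change0.
(* By [1 + x <= expR x] the mean splits into one exponential per copy. *)
apply: le_trans (ler_wpM2l F0 (expR_ge1Dx _)) _.
rewrite expR_sum /F -big_split /= ler_prod // => i _.
rewrite mulr_ge0 ?expR_ge0 ?(ltW (factor_gt0 _ _)) //=.
by apply: factor_descent => //; [lia | exact: ok].
Qed.

Lemma miss_prob_start m n (G : sgraph 'I_n) :
  (1 < n)%N -> (N <= 2 * n.-1)%N -> (n + m = N)%N -> pa_tree G ->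
  exists2 K, (n <= 2 * K)%N & miss_prob m G <= (1 - gain m (size b)) ^+ K.
Proof.
move=> n1 nN nm tG; have [sd _ tr] := tG.
pose A := [set v | (deg G v <= 4)%N]; exists #|A|.
  (* The degrees sum to [2 * n.-1], so fewer than half of the vertices have degree 5 or more. *)
  have le : (\sum_(v in ~: A) 5 <= \sum_v deg G v)%N.
    rewrite big_mkcond /=; apply: leq_sum => v _; rewrite !inE.
    by case: ifP => //; rewrite -ltnNge.
  have := cardsC A; rewrite card_ord.
  move: le; rewrite sum_nat_const sd; lia.
(* Each vertex of degree at most 4 starts a copy reduced to its root; the summand 4 in [copy_ok]
   covers its initial degree. *)
pose c (i : 'I_#|A|) := Some (enum_val i, [::] : seq 'I_n).
have <- : \prod_i factor m (c i) = (1 - gain m (size b)) ^+ #|A|.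
  rewrite (eq_bigr (fun=> 1 - gain m (size b))) ?prodr_const ?card_ord //.
  by move=> i _; rewrite /= subn0.
apply: miss_prob_le => //.
  move=> i _ [<-]; split => //=.
  - by rewrite take0; split=> //= a a'; lia.
  - have -> : ~: [set x in [::]] = [set: 'I_n] by apply/setP => x; rewrite !inE.
    exact: tr.
  - by have := enum_valP i; rewrite inE.
move=> i j x ij; rewrite !inE => /eqP ->; apply: contra ij => /eqP.
by move/enum_val_inj => ->.
Qed.

Lemma pa_miss_le m k K : ((m + k).+2 = N)%N -> (N <= 2 * k.+1)%N ->
  (2 * K <= k.+2)%N ->
  \sum_(G : sgraph 'I_(m + k).+2) pa_law R G * miss_prob 0 G <=
  (1 - gain m (size b)) ^+ K.
Proof.
move=> mk kN Kk; rewrite pa_law_miss addn0.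
have /andP[g0 g1] := gain_bounds m (size b) eps0 W1 WN.
rewrite -[leRHS]mul1r -[X in X * _](pa_law_sum R k) mulr_suml.
apply: ler_pa_law => G tG.
have kmN : (k.+2 + m = N)%N by lia.
have [K' nK le] := miss_prob_start (isT : (1 < k.+2)%N) kN kmN tG.
(* Additional copies only multiply by factors at most 1. *)
apply: le_trans le _; rewrite ler_wiXn2l //; [lra | lra | lia].
Qed.

End Miss.

(** * Asymptotics of the bound *)

(* With [m = N / 2W] steps to go, the binomial lower bound for [gain m (size b)]
   does not depend on [N]. *)
Lemma gain_unif (R : realType) (W i : nat) : (0 < W)%N ->
  exists2 c0 : R, 0 < c0 <= 1 / 2 &
  exists N0 : nat, forall N : nat, (N0 <= N)%N ->
    c0 <= gain W%:R ((2 * N)%:R^-1 : R) (N %/ (2 * W)) i.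
Proof.
(* [r] bounds [(m - i) * (eps / 2) = (m - i) / (4 * N)] from below, given [m - i >= N / (4 * W)]. *)
move=> W0; pose r : R := (16 * W)%:R^-1.
have r0 : 0 < r by rewrite invr_gt0 ltr0n muln_gt0.
have r1 : r <= 1 by rewrite invf_le1 ?ler1n ?ltr0n muln_gt0.
exists (1 / 4 * r ^+ i / (i`!)%:R).
  have f0 : 0 < (i`!)%:R :> R by rewrite ltr0n fact_gt0.
  rewrite divr_gt0 ?mulr_gt0 ?exprn_gt0 //= ler_pdivrMr //.
  have : r ^+ i <= 1 by rewrite exprn_ile1 // ltW.
  have : 1 <= (i`!)%:R :> R by rewrite ler1n fact_gt0.
  lra.
(* From [m + 1 > N / (2 * W)], this threshold yields [m - i >= N / (4 * W)]. *)
exists (4 * W * (i.+1))%N => N hN; set m := (N %/ (2 * W))%N.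
have N0 : (0 < N)%N by nia.
set eps : R := (2 * N)%:R^-1.
have eps0 : 0 < eps by rewrite invr_gt0 ltr0n muln_gt0.
have mN : (m * (2 * W) <= N)%N by exact: leq_divM.
have Nm : (N < m.+1 * (2 * W))%N by rewrite ltn_ceil // muln_gt0.
have NE : N%:R != 0 :> R by rewrite pnatr_eq0 -lt0n.
have Wx : 2 * W%:R * eps = W%:R / N%:R.
  by rewrite /eps natrM; field.
have WN : W%:R * eps <= 1 / 2.
  have : W%:R / N%:R <= 1 :> R.
    by rewrite ler_pdivrMr ?ltr0n // mul1r ler_nat; nia.
  rewrite -Wx; lra.
apply: le_trans (gain_ge m i eps0 _ WN); last by rewrite ler1n.
have pw : 1 / 2 <= (1 - 2 * W%:R * eps) ^+ m.
  apply: le_trans (bernoulli_le m _); last first.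
    by apply/andP; split; [rewrite mulr_ge0 // ltW | lra].
  suff : m%:R * (2 * W%:R * eps) <= 1 / 2 by lra.
  rewrite Wx mulrA ler_pdivrMr ?ltr0n //.
  have : (m * (2 * W))%:R <= N%:R :> R by rewrite ler_nat.
  rewrite !natrM; lra.
(* ['C(m, i)] times [i!] is a falling factorial, which is at least [(m - i) ^ i]. *)
have bn : r ^+ i / (i`!)%:R <= 'C(m, i)%:R * (eps / 2) ^+ i.
  rewrite ler_pdivrMr ?ltr0n ?fact_gt0 // mulrAC -natrM bin_ffact.
  apply: le_trans (_ : ((m - i) ^ i)%:R * (eps / 2) ^+ i <= _); last first.
    by rewrite ler_wpM2r ?exprn_ge0 ?ler_nat ?expn_le_ffact // divr_ge0 // ltW.
  rewrite natrX -exprMn.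
  rewrite lerXn2r ?nnegrE ?mulr_ge0 ?divr_ge0 ?(ltW eps0) ?(ltW r0) //.
  have : (N <= 4 * W * (m - i))%N by nia.
  rewrite -(ler_nat R) natrM => le.
  have -> : (m - i)%:R * (eps / 2) = (m - i)%:R / (4 * N%:R) :> R.
    by rewrite /eps natrM; field.
  rewrite /r ler_pdivlMr ?mulr_gt0 ?ltr0n // mulrC.
  rewrite ler_pdivrMr ?ltr0n ?muln_gt0 //.
  move: le; rewrite !natrM; lra.
apply: le_trans (_ : 1 / 2 * (1 / 2) * ('C(m, i)%:R * (eps / 2) ^+ i) <= _).
  rewrite -mulrA (_ : 1 / 2 * (1 / 2) = 1 / 4 :> R); last by field.
  by rewrite ler_wpM2l //; lra.
rewrite -[leRHS]mulrA ler_wpM2r ?mulr_ge0 ?exprn_ge0 ?divr_ge0 ?(ltW eps0) //.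
lra.
Qed.

Lemma pa_has_copy (R : realType) (b : seq nat) (e : R) : parents_ok b -> 0 < e ->
  exists k0, forall k, (k0 <= k)%N ->
  \sum_(G : sgraph 'I_k.+2 | ~~ `[< has_copy b G >]) pa_law R G <= e.
Proof.
move=> b_ok e0; pose W := (2 * ((size b).+1 * (size b + 4)))%N.
have W8 : (8 <= W)%N by rewrite /W; nia.
have W0 : (0 < W)%N by exact: leq_trans W8.
have [c0 /andP[c00 c01] [N0 H]] := @gain_unif R W (size b) W0.
have [K0 HK] : exists K0, (1 - c0) ^+ K0 <= e.
  have : ((fun n => (1 - c0) ^+ n) @ \oo --> (0 : R))%classic.
    by apply: cvg_expr; rewrite ger0_norm; lra.
  move/cvgrPdist_le => /(_ _ e0)[K0 _ HK]; exists K0.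
  by have := HK K0 (leqnn _); rewrite sub0r normrN ger0_norm // exprn_ge0; lra.
(* [N0] ensures the uniform gain, [4 * K0] that at least [K0] copies are started, and [2 * W] that
   [W * eps <= 1 / 2]. *)
exists (N0 + 4 * K0 + 2 * W)%N => k hk.
pose N := k.+2; pose m := (N %/ (2 * W))%N.
have mN : (m * (2 * W) <= N)%N by exact: leq_divM.
have gN : c0 <= gain W%:R (2 * N)%:R^-1 m (size b) by apply: H; rewrite /N; lia.
have -> : \sum_(G : sgraph 'I_k.+2 | ~~ `[< has_copy b G >]) pa_law R G =
    \sum_(G : sgraph 'I_k.+2) pa_law R G * miss_prob R b 0 G.
  rewrite big_mkcond /=; apply: eq_bigr => G _.
  by case: ifP => _; rewrite ?mulr1 ?mulr0.
have [k' kE] : exists k', k = (m + k')%N by exists (k - m)%N; nia.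
have NW : W%:R * (2 * N)%:R^-1 <= 1 / 2 :> R.
  rewrite ler_pdivrMr ?ltr0n // natrM.
  have : W%:R <= N%:R :> R by rewrite ler_nat /N; lia.
  lra.
(* The copies start at time [N - m], which is at least [15 * N / 16]. *)
have m8 : (16 * m <= N)%N by nia.
move: gN NW m8 mN; move: (m) kE => {}m kE gN NW m8 mN.
have NE : N = k.+2 by [].
clearbody N; subst k.
apply: le_trans HK.
apply: le_trans (_ : (1 - gain W%:R (2 * N)%:R^-1 m (size b)) ^+ K0 <= _).
  by apply: pa_miss_le => //; lia.
have eps0 : 0 < (2 * N)%:R^-1 :> R by rewrite invr_gt0 ltr0n; lia.
have W1 : 1 <= W%:R :> R by rewrite ler1n; lia.
have /andP[g0 g1] := gain_bounds m (size b) eps0 W1 NW.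
by apply: lerXn2r; rewrite ?nnegrE; lra.
Qed.

(** * The zero-one law *)

Lemma deciding_tree phi : sentence phi -> exists2 b, parents_ok b &
  forall n (G : sgraph 'I_n), has_copy b G ->
    (models G phi <-> models (parent_graph b) phi).
Proof.
(* The largest set index used by the encoding of variables is [(vmax phi).*2.+1]. *)
move=> sphi; pose V := (vmax phi).*2.+2; pose k := qdepth phi.
have [b b_ok absb] := absorbing_tree V k; exists b => // n G [c cok sz].
apply: (@models_tp V k _ _ _ _ _ c.1 ord0) => //.
exact: (tp_full_copy absb cok sz).
Qed.

Lemma pa_prob_split (R : realType) k phi :
  pa_prob R k phi +
    \sum_(G : sgraph 'I_k.+2 | ~~ `[< models G phi >]) pa_law R G = 1.
Proof.
by rewrite -(pa_law_sum R k) [RHS](bigID (fun G => `[< models G phi >])).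
Qed.

Lemma ler_sum_pred (R : realType) (I : finType) (P Q : pred I) (F : I -> R) :
  (forall i, 0 <= F i) -> (forall i, P i -> Q i) ->
  \sum_(i | P i) F i <= \sum_(i | Q i) F i.
Proof.
move=> F0 PQ; rewrite [leLHS]big_mkcond [leRHS]big_mkcond /=.
apply: ler_sum => i _.
by case: (boolP (P i)) => [/PQ -> //|_]; case: ifP.
Qed.

Unset Implicit Arguments.
Local Open Scope classical_set_scope.

Theorem theorem2 (R : realType) (phi : mso) (hphi : sentence phi) :
  (pa_prob R k phi @[k --> \oo] --> (0 : R)) \/
  (pa_prob R k phi @[k --> \oo] --> (1 : R)).
Proof.
have [b b_ok dec] := deciding_tree hphi.
have law0 k (G : sgraph 'I_k.+2) : 0 <= pa_law R G by exact: pa_law_ge0.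
(* The limit is the truth value of [phi] on the tree coded by [b]; the error is at most the
   probability that no copy of [b] is present. *)
have [mb|nmb] := pselect (models (parent_graph b) phi); [right | left].
- apply/cvgrPdist_le => e /(pa_has_copy b_ok)[k0 Hk0]; exists k0 => // k /Hk0.
  apply: le_trans; rewrite -[X in `|X - _|](pa_prob_split R k phi) addrAC subrr.
  rewrite add0r ger0_norm ?sumr_ge0 //; apply: ler_sum_pred => // G.
  by apply: contraNN => /asboolP/dec ?; apply/asboolP; tauto.
- apply/cvgrPdist_le => e /(pa_has_copy b_ok)[k0 Hk0]; exists k0 => // k /Hk0.
  apply: le_trans; rewrite sub0r normrN ger0_norm ?sumr_ge0 //.
  apply: ler_sum_pred => // G /asboolP mG.
  by apply/negP => /asboolP/dec; tauto.
Qed.
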